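(* Let $\mathscr{M}=\{m_n\}_{n\in\mathbb{N}_0}$ be a weight sequence, let $R,S\in\mathbb{N}$ with $R+S=N$, and let $u\in\mathscr{D}'_{\mathscr{M}}(\mathbb{T}^N)$. Then $$u=\sum_{\eta\in\mathbb{Z}^S}\widehat u(t,\eta)\,e^{ix\eta},$$ with convergence in $\mathscr{D}'_{\mathscr{M}}(\mathbb{T}^N)$. Moreover, for every $\varepsilon,h>0$ there exists $C_{\varepsilon,h}>0$ such that $$|\langle\widehat u(t,\eta),\psi\rangle|\le C_{\varepsilon,h}\cdot\|\psi\|_{\mathscr{M},h}\cdot\sup_{p\in\mathbb{N}_0}\left(\frac{\varepsilon^p(1+|\eta|)^p}{m_p\cdot p!}\right),\qquad\forall\eta\in\mathbb{Z}^S,\ \forall\psi\in\mathcal{E}_{\mathscr{M},h}(\mathbb{T}^R).$$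
   Context: $\mathbb{N}=\{1,2,\dots\}$, $\mathbb{N}_0=\mathbb{N}\cup\{0\}$, $\mathbb{T}^N=\mathbb{R}^N/2\pi\mathbb{Z}^N$, and $|\eta|$ is the Euclidean norm of $\eta\in\mathbb{Z}^S$. A weight sequence is a sequence $\mathscr{M}=\{m_n\}_{n\in\mathbb{N}_0}$ of positive reals with: $m_0=m_1=1$; $m_n^2\le m_{n-1}m_{n+1}$ for all $n\in\mathbb{N}$; and there is $H>1$ with $m_{j+k}\le H^{j+k}m_jm_k$ for all $j,k\in\mathbb{N}_0$. For each dimension $d$, $\mathcal{E}_{\mathscr{M}}(\mathbb{T}^d)$ is the space of $f\in C^\infty(\mathbb{T}^d)$ (complex-valued) for which there are $C,h>0$ with $|D^\alpha f(x)|\le C h^{|\alpha|}m_{|\alpha|}|\alpha|!$ for all $x\in\mathbb{T}^d$, $\alpha\in\mathbb{N}_0^d$, where $D=-i\partial$. For $h>0$, $\mathcal{E}_{\mathscr{M},h}(\mathbb{T}^d)$ is the Banach space of those $f$ with $\|f\|_{\mathscr{M},h}:=\sup_{x,\alpha}\frac{|D^\alpha f(x)|}{h^{|\alpha|}m_{|\alpha|}|\alpha|!}<\infty$. $\mathcal{E}_{\mathscr{M}}(\mathbb{T}^d)$ carries the locally convex inductive limit topology of the spaces $\mathcal{E}_{\mathscr{M},h_n}(\mathbb{T}^d)$ for any strictly increasing positive sequence $h_n\to+\infty$ (the topology does not depend on the choice). $\mathscr{D}'_{\mathscr{M}}(\mathbb{T}^d)$ is the topological dual of $\mathcal{E}_{\mathscr{M}}(\mathbb{T}^d)$;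 a sequence $u_n\to u$ in $\mathscr{D}'_{\mathscr{M}}(\mathbb{T}^d)$ if $\langle u_n,\varphi\rangle\to\langle u,\varphi\rangle$ for all $\varphi\in\mathcal{E}_{\mathscr{M}}(\mathbb{T}^d)$. Points of $\mathbb{T}^N$ are written $(t,x)$ with $t\in\mathbb{T}^R$, $x\in\mathbb{T}^S$. For $u\in\mathscr{D}'_{\mathscr{M}}(\mathbb{T}^N)$ and $\eta\in\mathbb{Z}^S$, the partial Fourier coefficient $\widehat u(t,\eta)\in\mathscr{D}'_{\mathscr{M}}(\mathbb{T}^R)$ is defined by $\langle\widehat u(t,\eta),\psi\rangle=\frac{1}{(2\pi)^S}\langle u,\psi(t)e^{-ix\eta}\rangle$ for $\psi\in\mathcal{E}_{\mathscr{M}}(\mathbb{T}^R)$ (notational only: it need not be a function of $t$). For $v\in\mathscr{D}'_{\mathscr{M}}(\mathbb{T}^R)$, $v\,e^{ix\eta}\in\mathscr{D}'_{\mathscr{M}}(\mathbb{T}^N)$ is given by $\langle v\,e^{ix\eta},\lambda\rangle=\left\langle v,\int_{\mathbb{T}^S}\lambda(t,x)e^{ix\eta}\,dx\right\rangle$. Convergence of a series over $\mathbb{Z}^S$ means convergence of the partial sums over $|\eta|\le k$ as $k\to\infty$. *)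

(* Defs.v *)
From HB Require Import structures.
From mathcomp Require Import all_boot all_order all_algebra.
From mathcomp Require Import complex.
From mathcomp Require Import all_classical all_reals all_analysis.

Set Implicit Arguments.
Unset Strict Implicit.
Unset Printing Implicit Defensive.

Import Order.TTheory GRing.Theory Num.Theory.
Import numFieldNormedType.Exports.

Local Open Scope classical_set_scope.
Local Open Scope ring_scope.
Local Open Scope complex_scope.

Notation normc := ComplexField.Normc.normc.

Definition weight_sequence (R : realType) (m : nat -> R) : Prop :=
  [/\ forall n, 0 < m n,
      m 0%N = 1 /\ m 1%N = 1,
      forall n, (0 < n)%N -> m n ^+ 2 <= m n.-1 * m n.+1 &
      exists2 H : R, 1 < H &
        forall j k, m (j + k)%N <= H ^+ (j + k) * m j * m k].

(* Functions on the torus (R / 2 pi Z)^d are the functions on R^d which are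
   2 pi-periodic in each variable. *)
Definition torus_periodic (R : realType) (d : nat) (f : 'rV[R]_d -> R[i]) : Prop :=
  forall (x : 'rV[R]_d) (k : 'rV[int]_d),
    f (x + (2 * pi) *: map_mx intr k) = f x.

(* The variables are real and the values complex, so the partial derivatives
   are taken on the real and imaginary parts. *)
Definition pderivable (R : realType) (d : nat) (j : 'I_d)
    (f : 'rV[R]_d -> R[i]) (x : 'rV[R]_d) : Prop :=
  derivable (fun y => complex.Re (f y)) x (delta_mx 0 j) /\
  derivable (fun y => complex.Im (f y)) x (delta_mx 0 j).

Definition pderive (R : realType) (d : nat) (j : 'I_d)
    (f : 'rV[R]_d -> R[i]) : 'rV[R]_d -> R[i] :=
  fun x => 'D_(delta_mx 0 j) (fun y => complex.Re (f y)) x +i*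
           'D_(delta_mx 0 j) (fun y => complex.Im (f y)) x.

(* All iterated partial derivatives, in any order, exist and are continuous. *)
Definition smooth (R : realType) (d : nat) (f : 'rV[R]_d -> R[i]) : Prop :=
  forall w : seq 'I_d, let g := foldr (@pderive R d) f w in
    [/\ continuous (fun x => complex.Re (g x)),
        continuous (fun x => complex.Im (g x)) &
        forall j x, pderivable j g x].

Definition Dj (R : realType) (d : nat) (j : 'I_d)
    (f : 'rV[R]_d -> R[i]) : 'rV[R]_d -> R[i] :=
  fun x => (0 -i* 1) * pderive j f x.

Definition Dalpha (R : realType) (d : nat) (alpha : 'I_d -> nat)
    (f : 'rV[R]_d -> R[i]) : 'rV[R]_d -> R[i] :=
  foldr (fun j g => iter (alpha j) (@Dj R d j) g) f (enum 'I_d).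

Definition mdeg (d : nat) (alpha : 'I_d -> nat) : nat :=
  (\sum_(j < d) alpha j)%N.

Definition ultradiff (R : realType) (m : nat -> R) (d : nat)
    (f : 'rV[R]_d -> R[i]) : Prop :=
  [/\ torus_periodic f, smooth f &
      exists C h : R, [/\ 0 < C, 0 < h & forall x alpha,
        normc (Dalpha alpha f x) <=
          C * h ^+ mdeg alpha * m (mdeg alpha) * (mdeg alpha)`!%:R]].

Definition ultranorm (R : realType) (m : nat -> R) (h : R) (d : nat)
    (f : 'rV[R]_d -> R[i]) : \bar R :=
  ereal_sup [set (normc (Dalpha xa.2 f xa.1) /
      (h ^+ mdeg xa.2 * m (mdeg xa.2) * (mdeg xa.2)`!%:R))%:E
    | xa in [set: 'rV[R]_d * ('I_d -> nat)]].

Definition ultradiffh (R : realType) (m : nat -> R) (h : R) (d : nat)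
    (f : 'rV[R]_d -> R[i]) : Prop :=
  [/\ torus_periodic f, smooth f & (ultranorm m h f < +oo)%E].

Definition exhausting (R : realType) (h_ : nat -> R) : Prop :=
  [/\ forall n, 0 < h_ n, forall n, h_ n < h_ n.+1 & h_ @ \oo --> +oo].

Definition absconvex (R : realType) (d : nat)
    (V : set ('rV[R]_d -> R[i])) : Prop :=
  forall (a b : R[i]) f g, V f -> V g ->
    normc a + normc b <= 1 ->
    V (fun x => a * f x + b * g x).

(* Neighbourhoods of 0 in the locally convex inductive limit: a fundamental
   system is given by the absolutely convex V whose trace on each Banach space
   of the sequence is a neighbourhood of 0. *)
Definition indlim_nbhs0 (R : realType) (m h_ : nat -> R) (d : nat)
    (W : set ('rV[R]_d -> R[i])) : Prop :=
  exists V : set ('rV[R]_d -> R[i]),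
    [/\ V `<=` @ultradiff R m d,
        absconvex V,
        forall n, exists2 r : R, 0 < r &
          forall f, ultradiffh m (h_ n) f ->
            (ultranorm m (h_ n) f < r%:E)%E -> V f &
        V `<=` W].

(* A functional is a total map on functions; only its values on the
   ultradifferentiable functions matter. *)
Definition functional (R : realType) (d : nat) : Type :=
  ('rV[R]_d -> R[i]) -> R[i].

Definition ultradist (R : realType) (m h_ : nat -> R) (d : nat)
    (u : functional R d) : Prop :=
  (forall (a b : R[i]) f g, ultradiff m f -> ultradiff m g ->
     u (fun x => a * f x + b * g x) = a * u f + b * u g) /\
  (forall f (e : R), ultradiff m f -> 0 < e ->
     exists2 W, indlim_nbhs0 m h_ W &
       forall g, ultradiff m g -> W (fun x => g x - f x) ->
         normc (u g - u f) < e).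

Definition ultradist_cvg (R : realType) (m h_ : nat -> R) (d : nat)
    (u_ : nat -> functional R d) (u : functional R d) : Prop :=
  [/\ forall n, ultradist m h_ (u_ n),
      ultradist m h_ u &
      forall phi, ultradiff m phi ->
        normc (u_ n phi - u phi) @[n --> \oo] --> (0 : R)].

Definition dotZ (R : realType) (s : nat) (x : 'rV[R]_s) (eta : 'rV[int]_s) : R :=
  \sum_(j < s) x ord0 j * (eta ord0 j)%:~R.

Definition expi (R : realType) (y : R) : R[i] := cos y +i* sin y.

Definition eucl (R : realType) (s : nat) (eta : 'rV[int]_s) : R :=
  Num.sqrt (\sum_(j < s) (eta ord0 j)%:~R ^+ 2).

(* Integral over the cube [0, 2 pi]^s as an iterated Lebesgue integral; used
   only for continuous integrands. *)
Fixpoint torus_Rint (R : realType) (s : nat) : ('rV[R]_s -> R) -> R :=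
  match s return ('rV[R]_s -> R) -> R with
  | 0%N => fun f => f 0
  | s'.+1 => fun f =>
      \int[@lebesgue_measure R]_(a in `[0, 2 * pi])
        torus_Rint (fun y : 'rV[R]_s' => f (row_mx (const_mx a : 'rV_1) y))
  end.

Definition torus_int (R : realType) (s : nat) (f : 'rV[R]_s -> R[i]) : R[i] :=
  torus_Rint (fun x => complex.Re (f x)) +i*
  torus_Rint (fun x => complex.Im (f x)).

(* A point (t, x) of T^(r + s) is row_mx t x. *)
Definition partial_fourier (R : realType) (r s : nat)
    (u : functional R (r + s)) (eta : 'rV[int]_s) : functional R r :=
  fun psi => ((2 * pi) ^- s)%:C *
    u (fun z => psi (lsubmx z) * expi (- dotZ (rsubmx z) eta)).

Definition mul_char (R : realType) (r s : nat)
    (v : functional R r) (eta : 'rV[int]_s) : functional R (r + s) :=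
  fun lambda =>
    v (fun t => torus_int (fun x => lambda (row_mx t x) * expi (dotZ x eta))).

Definition fourier_partial_sum (R : realType) (r s : nat)
    (u : functional R (r + s)) (k : nat) : functional R (r + s) :=
  fun phi => \sum_(eta \in [set eta : 'rV[int]_s | eucl R eta <= k%:R])
    mul_char (partial_fourier u eta) eta phi.

(* Main.v *)
Require Import Defs.
From mathcomp Require Import all_boot all_order all_algebra.
From mathcomp Require Import complex.
From mathcomp Require Import all_classical all_reals all_analysis.
From mathcomp Require Import ring lra zify.

(** The proof splits the test functions, not the ultradistribution.

    For a smooth function [f] on the torus, let [eproj j n f] be its component
    of frequency [-n] in the variable [j].  Taking components commutes with all
    partial derivatives, and on a component the derivative in the variable [j]
    is multiplication by [-i n] ([eproj_pd], [eproj_by_parts]).  The iterated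
    component [eprojs] in all the variables x, at frequency [-eta], is exactly
    the function on which [u] is tested by the term of index [eta] of the
    series ([mul_char_eprojs]).  So the convergence of the series says that
    [u] of the partial sums of the components of [phi] tends to [u phi].

    A linear functional is continuous on the inductive limit if and only if it
    is bounded on every ball of every Banach space of the family
    ([ultradist_bounded], [bounded_ultradist]).  Hence it is enough to work
    with the estimates of a single Banach space, whose parameter [h] may be
    enlarged.  Differentiating a bounded number of times only enlarges [h], by
    the stability condition on the weights ([wt_shift]), and this is what makes
    the following two facts quantitative:
    - the truncation of [f] to the frequencies of modulus at most [K], in one
      variable and then in all of them, differs from [f] by O(1/K) in a space
      with larger [h] ([tprojs_rate]); this rests on the classical rate for the
      Dirichlet kernel applied to twice differentiable functions
      ([dirichlet_rate]);
    - the component at [eta] is O(|eta_k|^-p) for each coordinate [k] and each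
      [p] ([udball_eprojs_decay]).
    The first one gives the convergence of the sums over cubes of frequencies.
    The second one shows that what lies in the cube but outside the Euclidean
    ball is negligible ([partial_sum_rate]).

    The norms of the Banach spaces only see derivatives taken in one fixed
    order of the variables, whereas the argument differentiates in any order.
    The two are reconciled by the symmetry of second derivatives, which for
    smooth periodic functions also follows from the convergence of Fourier
    series ([pderiveC]).

    The estimate of the coefficients is [udball_tens]: in a derivative of
    [psi(t) e^{-ix eta}] the [q] derivatives in x produce a factor at most
    [|eta|^q], and [eps^q |eta|^q] is at most [m_q q!] times the supremum of
    the statement; by logarithmic convexity [m_p m_q <= m_(p+q)], so that
    [psi(t) e^{-ix eta}] lies in the Banach space of parameter
    [max h eps^-1], where [u] is bounded. *)

Set Implicit Arguments.
Unset Strict Implicit.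
Unset Printing Implicit Defensive.

Import Order.TTheory GRing.Theory Num.Theory.
Import numFieldNormedType.Exports.

Local Open Scope classical_set_scope.
Local Open Scope ring_scope.

(** * Integration over a period *)

Section RealLine.
Variable R : realType.
Implicit Types (f g F : R -> R).

Definition pint (f : R -> R) : R :=
  \int[@lebesgue_measure R]_(a in `[0, 2 * pi]) f a.

Lemma twopi_gt0 : 0 < 2 * pi :> R.
Proof. by rewrite mulr_gt0// pi_gt0. Qed.

Lemma is_derive_continuous f (df : R -> R) :
  (forall x : R, is_derive x 1 f (df x)) -> continuous f.
Proof.
move=> fd x; apply/differentiable_continuous/derivable1_diffP.
by have [] := fd x.
Qed.

Lemma continuous_integrable f (a b : R) : continuous f ->
  (@lebesgue_measure R).-integrable `[a, b] (EFin \o f).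
Proof.
move=> cf; apply: continuous_compact_integrable; first exact: segment_compact.
exact: continuous_subspaceT.
Qed.

Lemma derive_bound f (df : R -> R) (B : R) (x y : R) :
  (forall z : R, is_derive z 1 f (df z)) -> (forall z, `|df z| <= B) ->
  `|f y - f x| <= B * `|y - x|.
Proof.
move=> fd fB; have cf := is_derive_continuous fd.
have H a b : a <= b -> `|f b - f a| <= B * `|b - a|.
  move=> ab.
  have [//|c _ ->] := @MVT_segment R f df a b ab (fun x _ => fd x).
    exact: continuous_subspaceT.
  by rewrite normrM ler_wpM2r.
case: (leP x y) => [|/ltW] xy; first exact: H.
by rewrite distrC (distrC y); exact: H.
Qed.

(** An oscillatory integral can be estimated from a function F which is a
    primitive of g only up to an error of slope C: the mean value theorem is
    applied to the difference of F and a true primitive, so the error is never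
    integrated and may be singular at the ends of the period. *)
Lemma pint_near_primitive g F (dF : R -> R) (C : R) :
  continuous g -> {within `[0, 2 * pi], continuous F} ->
  (forall x : R, x \in `]0, 2 * pi[ -> is_derive x 1 F (dF x)) ->
  (forall x : R, x \in `]0, 2 * pi[ -> `|dF x - g x| <= C) ->
  `|pint g - (F (2 * pi) - F 0)| <= C * (2 * pi).
Proof.
move=> cg cF Fd dFg; have p0 := twopi_gt0.
pose G x := parameterized_integral (@lebesgue_measure R) 0 x g.
have intg u : (@lebesgue_measure R).-integrable `[0, u] (EFin \o g).
  exact: continuous_integrable.
have Gd x : x \in `]0, 2 * pi[ -> is_derive x 1 G (g x).
  rewrite in_itv/= => /andP[x0 x2].
  have [dG G'] := continuous_FTC1_closed x2 (intg _) x0 (cg x).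
  by apply: DeriveDef; [exact: dG | rewrite -derive1E; exact: G'].
have cG : {within `[0, 2 * pi], continuous G}.
  exact: (parameterized_integral_continuous (ltW p0) (intg _)).
have [|x xI|c cI] := @MVT R (G - F) (g - dF) 0 (2 * pi) p0.
- by move=> x xI; apply: is_deriveB; [exact: Gd|exact: Fd].
- by apply: continuousB; [exact: cG|exact: cF].
rewrite !fctE => E.
have G0 : G 0 = 0 by rewrite /G /parameterized_integral set_itv1 Rintegral_set1.
have -> : pint g - (F (2 * pi) - F 0) = (g c - dF c) * (2 * pi - 0).
  rewrite -E G0 /G /pint /parameterized_integral; ring.
by rewrite subr0 normrM (gtr0_norm p0) ler_wpM2r ?(ltW p0)// distrC dFg.
Qed.

Lemma pint_derive F (f : R -> R) :
  (forall x : R, is_derive x 1 F (f x)) -> continuous f ->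
  pint f = F (2 * pi) - F 0.
Proof.
move=> Fd cf; apply/eqP; rewrite -subr_eq0 -normr_le0.
rewrite -[leRHS](mul0r (2 * pi)); apply: (@pint_near_primitive _ _ f) => //.
  exact/continuous_subspaceT/(is_derive_continuous Fd).
by move=> x _; rewrite subrr normr0.
Qed.

Lemma pintD f g : continuous f -> continuous g ->
  pint (fun x => f x + g x) = pint f + pint g.
Proof. by move=> cf cg; rewrite /pint RintegralD//; exact: continuous_integrable. Qed.

Lemma pintZ (c : R) f : continuous f ->
  pint (fun x => c * f x) = c * pint f.
Proof. by move=> cf; rewrite /pint RintegralZl//; exact: continuous_integrable. Qed.

Lemma pint_cst (c : R) : pint (fun=> c) = c * (2 * pi).
Proof.
have H := @lebesgue_measure_itv R `[0, 2 * pi].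
rewrite /pint Rintegral_cst//= H /= lte_fin twopi_gt0.
by rewrite -EFinD /= subr0.
Qed.

Lemma pint_bound f (B : R) : continuous f -> (forall x, `|f x| <= B) ->
  `|pint f| <= B * (2 * pi).
Proof.
move=> cf fB; apply: le_trans (le_normr_Rintegral _ _) _ => //.
  exact: continuous_integrable.
rewrite -pint_cst; apply: le_Rintegral => //.
- apply: (@continuous_integrable (fun x => `|f x|)) => x.
  exact: (continuous_comp (cf x) (@norm_continuous _ R^o _)).
- by apply: (@continuous_integrable (fun=> B)) => x; exact: cvg_cst.
Qed.

Lemma continuous_fsum (T : topologicalType) (I : Type) (r : seq I)
    (f : I -> T -> R) :
  (forall i, continuous (f i)) -> continuous (fun x => \sum_(i <- r) f i x).
Proof.
move=> cf x; elim: r => [|i r IH].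
  by under eq_fun do rewrite big_nil; exact: cvg_cst.
under eq_fun do rewrite big_cons.
by apply: (@cvgD _ R^o); [exact: cf|exact: IH].
Qed.

Lemma pint_sum n (f : 'I_n -> R -> R) : (forall i, continuous (f i)) ->
  pint (fun x => \sum_(i < n) f i x) = \sum_(i < n) pint (f i).
Proof.
elim: n f => [|n IH] f cf.
  rewrite big_ord0 -[RHS](mul0r (2 * pi)) -pint_cst; congr pint.
  by apply/funext => x; rewrite big_ord0.
rewrite big_ord_recl -IH// -pintD//.
  by congr pint; apply/funext => x; rewrite big_ord_recl.
exact: continuous_fsum.
Qed.

Lemma pint_under_diff (F F1 : R -> R -> R) (B t0 : R) :
  (forall t, continuous (F t)) -> (forall t, continuous (F1 t)) ->
  (forall t a : R, is_derive t 1 (F ^~ a) (F1 t a)) ->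
  (forall t a, `|F1 t a| <= B) ->
  is_derive t0 1 (fun t => pint (F t)) (pint (F1 t0)).
Proof.
move=> cF cF1 FF1 F1B.
have d1 t a : partial1of2 F t a = F1 t a.
  by rewrite partial1of2E; have [_ ->] := FF1 t a.
have I0 : `]t0 - 1, t0 + 1[%classic t0 by rewrite /= in_itv/=; apply/andP; split; lra.
have intF x : `]t0 - 1, t0 + 1[%classic x ->
    (@lebesgue_measure R).-integrable `[0, 2 * pi] (EFin \o F x).
  by move=> _; exact: continuous_integrable.
have derF x a : `]t0 - 1, t0 + 1[%classic x -> `[0, 2 * pi]%classic a ->
    derivable (F ^~ a) x 1.
  by move=> _ _; have [] := FF1 x a.
have B0 (a : R) : 0 <= B by apply: le_trans (F1B 0 0); exact: normr_ge0.
have intB : (@lebesgue_measure R).-integrable `[0, 2 * pi] (EFin \o (fun _ : R => B)).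
  by apply: continuous_integrable => x; exact: cvg_cst.
have bndF x a : `]t0 - 1, t0 + 1[%classic x -> `[0, 2 * pi]%classic a ->
    `|partial1of2 F x a| <= B.
  by move=> _ _; rewrite d1.
apply: DeriveDef.
  exact: (derivable_under_integral _ I0 intF derF B0 intB bndF).
rewrite -derive1E (differentiation_under_integral _ I0 intF derF B0 intB bndF)//.
by rewrite /pint; apply: eq_Rintegral => a _; rewrite d1.
Qed.

(** The derivative of the left-hand side in x is the integral over a period of
    the derivative of a periodic function. *)
Lemma pint_shift g (dg : R -> R) (B x : R) :
  (forall y : R, is_derive y 1 g (dg y)) -> continuous dg ->
  (forall y, `|dg y| <= B) -> (forall y, g (y + 2 * pi) = g y) ->
  pint (fun a => g (x + a)) = pint g.
Proof.
move=> gd cdg dgB gp.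
have cg := is_derive_continuous gd.
have sh (h : R -> R) (t : R) : continuous h -> continuous (fun a => h (t + a)).
  move=> ch a; apply: (@continuous_comp _ _ _ (fun a => t + a) h); last exact: ch.
  by apply: continuousD; [exact: cvg_cst|exact: cvg_id].
have shd (t a : R) : is_derive a 1 (fun a => g (t + a)) (dg (t + a)).
  have H := gd (t + a).
  have H2 : is_derive a 1 (fun a => t + a) (1 : R).
    rewrite (_ : (fun a => t + a) = shift t); first exact: is_derive_shift.
    by apply/funext => b; rewrite /shift /= addrC.
  have := @is_derive1_comp R g (fun a => t + a) a _ _ H H2.
  by rewrite mulr1.
have H (t : R) : is_derive t 1 (fun t => pint (fun a => g (t + a))) 0.
  have /(_ B t) := @pint_under_diff (fun t a => g (t + a)) (fun t a => dg (t + a)).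
  have -> : pint (fun a => dg (t + a)) = 0.
    rewrite (@pint_derive (fun a => g (t + a))) ?addr0 ?gp ?subrr//.
    exact: sh.
  apply => //.
  - by move=> u; exact: sh.
  - by move=> u; exact: sh.
  - move=> u a; have := shd a u.
    by under eq_fun do rewrite addrC; rewrite addrC.
rewrite (@is_derive_0_is_cst _ (fun t => pint (fun a => g (t + a))) x 0)//.
by congr pint; apply/funext => a; rewrite add0r.
Qed.

End RealLine.

(** * The Dirichlet kernel *)

Section Dirichlet.
Variable R : realType.
Implicit Types (f g F : R -> R).

Lemma is_derive_sinM (c x : R) :
  is_derive x 1 (fun t => sin (t * c)) (c * cos (x * c)).
Proof.
have H : is_derive x 1 (fun t : R => t * c) c.
  have -> : (fun t : R => t * c) = (c \*: id).
    by apply/funext => t; rewrite /= mulrC.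
  by apply: is_derive_eq; rewrite /GRing.scale /= mulr1.
have := @is_derive1_comp R sin (fun t => t * c) x _ _ (is_derive_sin _) H.
by rewrite mulrC.
Qed.

Lemma is_derive_cosM (c x : R) :
  is_derive x 1 (fun t => cos (t * c)) (- (c * sin (x * c))).
Proof.
have H : is_derive x 1 (fun t : R => t * c) c.
  have -> : (fun t : R => t * c) = (c \*: id).
    by apply/funext => t; rewrite /= mulrC.
  by apply: is_derive_eq; rewrite /GRing.scale /= mulr1.
have := @is_derive1_comp R cos (fun t => t * c) x _ _ (is_derive_cos _) H.
by rewrite mulrC mulrN.
Qed.

Lemma continuous_sinM (c : R) : continuous (fun t : R => sin (t * c)).
Proof. exact: (is_derive_continuous (is_derive_sinM c)). Qed.

Lemma continuous_cosM (c : R) : continuous (fun t : R => cos (t * c)).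
Proof. exact: (is_derive_continuous (is_derive_cosM c)). Qed.

Lemma cos_2pi_nat (n : nat) (x : R) : cos (x + 2 * pi * n%:R) = cos x.
Proof.
elim: n => [|n IH]; first by rewrite mulr0 addr0.
rewrite -[RHS]IH -[RHS]cosD2pi; congr cos; rewrite -natr1 mulr2n; ring.
Qed.

Lemma sin_2pi_nat (n : nat) (x : R) : sin (x + 2 * pi * n%:R) = sin x.
Proof.
elim: n => [|n IH]; first by rewrite mulr0 addr0.
rewrite -[RHS]IH -[RHS]sinD2pi; congr sin; rewrite -natr1 mulr2n; ring.
Qed.

Lemma cos_2pi_int (n : int) (x : R) : cos (x + 2 * pi * n%:~R) = cos x.
Proof.
case: n => n; first exact: cos_2pi_nat.
rewrite -[LHS](cos_2pi_nat n.+1); congr cos; rewrite NegzE mulrNz; ring.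
Qed.

Lemma sin_2pi_int (n : int) (x : R) : sin (x + 2 * pi * n%:~R) = sin x.
Proof.
case: n => n; first exact: sin_2pi_nat.
rewrite -[LHS](sin_2pi_nat n.+1); congr sin; rewrite NegzE mulrNz; ring.
Qed.

Lemma pint_sin (k : int) : pint (fun t : R => sin (t * k%:~R)) = 0.
Proof.
have [->|k0] := eqVneq k 0.
  rewrite -[RHS](mul0r (2 * pi)) -pint_cst; congr pint; apply/funext => t.
  by rewrite mulr0 sin0.
have k0' : (k%:~R : R) != 0 by rewrite intr_eq0.
have Fd (x : R) : is_derive x 1 (fun t : R => (- k%:~R^-1) *: (cos (t * k%:~R) : R^o))
    (sin (x * k%:~R)).
  have H := @is_deriveZ _ _ _ _ (- k%:~R^-1) _ _ _ (is_derive_cosM k%:~R x).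
  by apply: is_derive_eq H _; rewrite /GRing.scale /=; field.
rewrite (pint_derive Fd); last exact: continuous_sinM.
by rewrite -[2 * pi * _]add0r cos_2pi_int mul0r subrr.
Qed.

Lemma pint_cos (k : int) :
  pint (fun t : R => cos (t * k%:~R)) = if k == 0 then 2 * pi else 0.
Proof.
case: eqVneq => [->|k0].
  rewrite -[RHS]mul1r -pint_cst; congr pint; apply/funext => t.
  by rewrite mulr0 cos0.
have k0' : (k%:~R : R) != 0 by rewrite intr_eq0.
have Fd (x : R) : is_derive x 1 (fun t : R => (k%:~R^-1) *: (sin (t * k%:~R) : R^o))
    (cos (x * k%:~R)).
  have H := @is_deriveZ _ _ _ _ (k%:~R^-1) _ _ _ (is_derive_sinM k%:~R x).
  by apply: is_derive_eq H _; rewrite /GRing.scale /=; field.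
rewrite (pint_derive Fd); last exact: continuous_cosM.
by rewrite -[2 * pi * _]add0r sin_2pi_int mul0r subrr.
Qed.

(** The frequencies -N, ..., N are indexed by 0, ..., 2N. *)
Definition freq (N i : nat) : int := i%:Z - N%:Z.

Definition dirichlet (N : nat) (t : R) : R :=
  \sum_(i < N.*2.+1) cos (t * (freq N i)%:~R).

(** The product of sin (t / 2) with each cosine is a difference, and the sum
    telescopes. *)
Lemma dirichlet_sin (N : nat) (t : R) :
  sin (t / 2) * dirichlet N t = sin (t * (N%:R + 2^-1)).
Proof.
pose g (i : nat) : R := sin (t * (i%:R - N%:R - 2^-1)).
have E i : 2 * (sin (t / 2) * cos (t * (freq N i)%:~R)) = g i.+1 - g i.
  rewrite /g /freq intrB.
  have -> : t * (i.+1%:R - N%:R - 2^-1) = t * (i%:~R - N%:~R) + t / 2.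
    by rewrite -natr1; field.
  have -> : t * (i%:R - N%:R - 2^-1) = t * (i%:~R - N%:~R) - t / 2.
    by field.
  rewrite sinD sinB; ring.
apply: (@mulfI _ 2); first by [].
rewrite /dirichlet mulr_sumr mulr_sumr.
under eq_bigr do rewrite E.
rewrite -(big_mkord xpredT (fun i => g i.+1 - g i)) telescope_sumr//.
have -> : g N.*2.+1 = sin (t * (N%:R + 2^-1)).
  by rewrite /g; congr sin; rewrite -natr1 -muln2 natrM; field.
have -> : g 0%N = - sin (t * (N%:R + 2^-1)).
  by rewrite /g -sinN; congr sin; field.
by rewrite opprK mulr_natl mulr2n.
Qed.

Lemma continuous_dirichlet N : continuous (dirichlet N).
Proof. by apply: continuous_fsum => i; exact: continuous_cosM. Qed.

Lemma sum_freq_eq0 (V : zmodType) N (x : V) :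
  \sum_(i < N.*2.+1) (if freq N i == 0 then x else 0) = x.
Proof.
have NN : (N < N.*2.+1)%N by rewrite ltnS -addnn leq_addr.
rewrite (bigD1 (Ordinal NN))//= {1}/freq subrr eqxx big1 ?addr0// => i iN.
rewrite /freq subr_eq0; case: eqP => // -[E].
by move: iN; rewrite -val_eqE /= E eqxx.
Qed.

Lemma pint_dirichlet N : pint (dirichlet N) = 2 * pi.
Proof.
rewrite /dirichlet pint_sum; last by move=> i; exact: continuous_cosM.
under eq_bigr do rewrite pint_cos.
exact: sum_freq_eq0.
Qed.

Lemma pint_sin_dirichlet N : pint (fun t => sin t * dirichlet N t) = 0.
Proof.
have -> : (fun t : R => sin t * dirichlet N t) =
  fun t => \sum_(i < N.*2.+1) (2^-1 * (sin (t * (1 + freq N i)%:~R) +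
     sin (t * (1 - freq N i)%:~R))).
  apply/funext => t; rewrite /dirichlet mulr_sumr; apply: eq_bigr => i _.
  have -> : t * (1 + freq N i)%:~R = t + t * (freq N i)%:~R by rewrite intrD; ring.
  have -> : t * (1 - freq N i)%:~R = t - t * (freq N i)%:~R by rewrite intrB; ring.
  by rewrite sinD sinB; field.
have cs i : continuous (fun t : R => sin (t * (1 + freq N i)%:~R) +
     sin (t * (1 - freq N i)%:~R)).
  by move=> t; apply: cvgD; exact: continuous_sinM.
rewrite pint_sum => [|i t].
  apply: big1 => i _; rewrite pintZ// pintD; last 2 first.
  - exact: continuous_sinM.
  - exact: continuous_sinM.
  by rewrite !pint_sin addr0 mulr0.
by apply: cvgM; [exact: cvg_cst|exact: cs].
Qed.

(** A weak form of Jordan's inequality: sin (x / 2) is twice the product of the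
    sine and the cosine of x / 4, the mean value theorem bounds the sine below
    by x / 4 times the cosine, and the cosine is at least 1 / sqrt 2. *)
Lemma sin_half_ge (x : R) : 0 < x <= pi -> x / 4 <= sin (x / 2).
Proof.
move=> /andP[x0 xpi].
have y0 : 0 < x / 4 by lra.
have pi0 := @pi_gt0 R.
have Hc t : 0 <= t <= x / 4 -> cos (x / 4) <= cos t.
  move=> /andP[t0 tx]; rewrite leNgt ltr_cos -?leNgt// in_itv/=;
  by apply/andP; split; lra.
have [//|c cI] := @MVT_segment R sin cos 0 (x / 4) (ltW y0) (fun z _ => is_derive_sin z).
  exact/continuous_subspaceT/continuous_sin.
rewrite sin0 !subr0 => sE.
have cc : cos (x / 4) <= cos c by apply: Hc; move: cI; rewrite in_itv/=.
have c0 : 0 < cos (x / 4) by apply: cos_gt0_pihalf; apply/andP; split; lra.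
have half : 2^-1 <= cos (x / 4) ^+ 2.
  have E : 0 <= cos (x / 2) by apply: cos_ge0_pihalf; apply/andP; split; lra.
  have : x / 2 = x / 4 *+ 2 by rewrite mulr2n; field.
  move=> xx; move: E; rewrite xx cos_mulr2n mulr2n; lra.
have -> : x / 2 = x / 4 *+ 2 by rewrite mulr2n; field.
rewrite sin_mulr2n sE mulr2n.
have H : cos (x / 4) ^+ 2 * (x / 4) <= cos (x / 4) * (cos c * (x / 4)).
  by rewrite [leRHS]mulrA ler_wpM2r ?(ltW y0)// expr2 ler_wpM2l// ltW.
have : 2^-1 * (x / 4) <= cos (x / 4) ^+ 2 * (x / 4) by rewrite ler_wpM2r// ltW.
lra.
Qed.

End Dirichlet.

(** * Rate of convergence of Fourier series in one variable *)

Section DirichletBound.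
Variable R : realType.
Implicit Types (f g F : R -> R).

Lemma double_zero_bound f f1 f2 (B x0 x : R) :
  (forall x : R, is_derive x 1 f (f1 x)) ->
  (forall x : R, is_derive x 1 f1 (f2 x)) ->
  (forall x, `|f2 x| <= B) -> f x0 = 0 -> f1 x0 = 0 ->
  `|f1 x| <= B * `|x - x0| /\ `|f x| <= B * `|x - x0| ^+ 2.
Proof.
move=> fd f1d f2B f0 f10.
have B0 : 0 <= B by apply: le_trans (f2B 0); exact: normr_ge0.
have H y : `|f1 y| <= B * `|y - x0|.
  by rewrite -[f1 y]subr0 -f10; exact: derive_bound f1d f2B.
split=> //.
have cf := is_derive_continuous fd.
have [xx|xx] := leP x0 x.
  have [|c cI E] := @MVT_segment R f f1 x0 x xx (fun z _ => fd z).
    exact: continuous_subspaceT.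
  move: cI; rewrite in_itv/= => /andP[c1 c2].
  move: E; rewrite f0 subr0 => ->; rewrite normrM expr2 mulrA ler_wpM2r//.
  apply: le_trans (H c) _; rewrite ler_wpM2l// !ger0_norm ?subr_ge0// lerD2r//.
have [|c cI E] := @MVT_segment R f f1 x x0 (ltW xx) (fun z _ => fd z).
  exact: continuous_subspaceT.
move: cI; rewrite in_itv/= => /andP[c1 c2].
have -> : f x = - (f1 c * (x0 - x)) by rewrite -E f0 sub0r opprK.
rewrite normrN normrM (distrC x0) expr2 mulrA ler_wpM2r//.
apply: le_trans (H c) _; rewrite ler_wpM2l// distrC (distrC x).
by rewrite !ger0_norm ?subr_ge0 ?(ltW xx)// lerD2l lerN2.
Qed.

(** The zeros of sin (x / 2) are the ends of the period, and d is the distance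
    to the nearest one. *)
Lemma sin_half_dist (x : R) : 0 < x < 2 * pi -> exists d : R,
  [/\ 0 < d, d / 4 <= sin (x / 2), d <= x, d <= 2 * pi - x &
    d = `|x - 0| \/ d = `|x - 2 * pi|].
Proof.
move=> /andP[x0 x2].
have [xpi|xpi] := leP x pi.
  exists x; split=> //; last by left; rewrite subr0 gtr0_norm.
    by apply: sin_half_ge; rewrite x0.
  lra.
exists (2 * pi - x); split=> //; [lra| |lra|by right; rewrite distrC gtr0_norm// subr_gt0].
have -> : sin (x / 2) = sin ((2 * pi - x) / 2).
  have -> : (2 * pi - x) / 2 = - (x / 2 - pi) by field.
  by rewrite sinN sinB sinpi cospi; ring.
by apply: sin_half_ge; apply/andP; split; lra.
Qed.

(** Put nu = N + 1/2 and q = f / sin (t / 2).  The integrand is q sin (nu t),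
    the derivative of - q cos (nu t) / nu up to q' cos (nu t) / nu.  As f has
    double zeros where the sine vanishes, q is continuous, vanishes at both
    ends, and its derivative is bounded by 12 B. *)
Lemma pint_dirichlet_double_zero f f1 f2 (B : R) (N : nat) :
  (forall x : R, is_derive x 1 f (f1 x)) ->
  (forall x : R, is_derive x 1 f1 (f2 x)) ->
  (forall x, `|f2 x| <= B) -> f 0 = 0 -> f1 0 = 0 ->
  f (2 * pi) = 0 -> f1 (2 * pi) = 0 ->
  `|pint (fun t => f t * dirichlet N t)| <= 12 * B / (N%:R + 2^-1) * (2 * pi).
Proof.
move=> fd f1d f2B f0 f10 fp f1p.
have B0 : 0 <= B by apply: le_trans (f2B 0); exact: normr_ge0.
set nu := N%:R + 2^-1.
have nu0 : 0 < nu by rewrite ltr_wpDl.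
have p0 := @twopi_gt0 R.
have bnd x : 0 < x < 2 * pi -> exists d : R,
  [/\ 0 < d, d / 4 <= sin (x / 2), d <= x, d <= 2 * pi - x &
    `|f1 x| <= B * d /\ `|f x| <= B * d ^+ 2].
  move=> /sin_half_dist[d [d0 ds dx d2 dE]]; exists d; split=> //.
  by case: dE => ->; exact: double_zero_bound fd f1d f2B _ _.
(* the approximate primitive; at both ends division by zero gives the value 0 *)
pose F x := - (f x / sin (x / 2) * (cos (x * nu) / nu)).
pose q1 x := f1 x / sin (x / 2) - f x * (cos (x / 2) / 2) / sin (x / 2) ^+ 2.
pose dF x := f x / sin (x / 2) * sin (x * nu) - q1 x * (cos (x * nu) / nu).
have Fd (x : R) : 0 < x < 2 * pi -> is_derive x 1 F (dF x).
  move=> /bnd[d [d0 ds _ _ _]].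
  have s0 : sin (x / 2) != 0.
    by rewrite gt_eqF// (lt_le_trans _ ds)// divr_gt0.
  have h1 := @is_deriveV R (fun t => sin (t * 2^-1)) x _ 1 s0 (is_derive_sinM _ _).
  have h2 := @is_deriveM _ _ _ _ _ _ _ _ (fd x) h1.
  have h3 := @is_deriveM _ _ _ _ _ _ _ _ h2 (is_derive_cosM nu x).
  have h4 := @is_deriveZ _ _ _ _ (- nu^-1) _ _ _ h3.
  have -> : F = (- nu^-1) \*: (f * (fun t => (sin (t * 2^-1))^-1) * (fun t => cos (t * nu))).
    apply/funext => t; rewrite /F /=.
    rewrite /GRing.scale /= !fctE; ring.
  apply: is_derive_eq h4 _.
  rewrite /GRing.scale /= !fctE /dF /q1.
  by field; rewrite s0 gt_eqF.
have Fb (x : R) : 0 < x < 2 * pi -> `|F x| <= 4 * B / nu * x /\ `|F x| <= 4 * B / nu * (2 * pi - x).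
  move=> /bnd[d [d0 ds dx d2 [_ fb]]].
  have s0 : 0 < sin (x / 2) by rewrite (lt_le_trans _ ds)// divr_gt0.
  have : `|F x| <= 4 * B / nu * d.
    rewrite /F normrN normrM normrM normfV (gtr0_norm s0) normrM normfV (gtr0_norm nu0).
    have h1 : `|f x| / sin (x / 2) <= 4 * B * d.
      rewrite ler_pdivrMr//; apply: le_trans fb _.
      have : 4 * B * d * (d / 4) <= 4 * B * d * sin (x / 2).
        by rewrite ler_wpM2l// !mulr_ge0// ltW.
      by apply: le_trans; rewrite le_eqVlt; apply/orP; left; apply/eqP; field.
    have h2 : `|cos (x * nu)| / nu <= nu^-1.
      by rewrite ler_piMl ?invr_ge0 ?(ltW nu0)// cos_max.
    have -> : 4 * B / nu * d = 4 * B * d * nu^-1 by ring.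
    by apply: ler_pM => //; rewrite divr_ge0// ltW.
  have K0 : 0 <= 4 * B / nu by rewrite !mulr_ge0// invr_ge0 ltW.
  by move=> H; split; apply: le_trans H _; rewrite ler_wpM2l.
have F0 : F 0 = 0 by rewrite /F f0 mul0r mul0r oppr0.
have Fp : F (2 * pi) = 0 by rewrite /F fp mul0r mul0r oppr0.
have K0 : 0 <= 4 * B / nu by rewrite !mulr_ge0// invr_ge0 ltW.
have cF : {within `[0, 2 * pi], continuous F}.
  apply/(continuous_within_itvP _ p0); split.
  - move=> x; rewrite in_itv/= => /Fd H.
    by apply/differentiable_continuous/derivable1_diffP; have [] := H.
  - rewrite F0; apply/cvgrPdist_le => e e0; near=> x.
    have x0 : 0 < x by near: x; exact: nbhs_right_gt.
    have [|Fx _] := Fb x; first by rewrite x0; near: x; exact: nbhs_right_lt.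
    rewrite sub0r normrN (le_trans Fx)//.
    have : x <= e / (4 * B / nu + 1).
      by near: x; apply: nbhs_right_le; rewrite divr_gt0// ltr_wpDl.
    rewrite ler_pdivlMr ?ltr_wpDl// => H; apply: le_trans H.
    by rewrite mulrC ler_wpM2l ?(ltW x0)// lerDl.
  - rewrite Fp; apply/cvgrPdist_le => e e0; near=> x.
    have x0 : x < 2 * pi by near: x; exact: nbhs_left_lt.
    have [|_ Fx] := Fb x; first by rewrite x0 andbT; near: x; exact: nbhs_left_gt.
    rewrite sub0r normrN (le_trans Fx)//.
    have : 2 * pi - x <= e / (4 * B / nu + 1).
      rewrite lerBlDl addrC -lerBlDl.
      by near: x; apply: nbhs_left_ge; rewrite ltrBlDl ltrDr divr_gt0// ltr_wpDl.
    rewrite ler_pdivlMr ?ltr_wpDl// => H; apply: le_trans H.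
    by rewrite mulrC ler_wpM2l ?subr_ge0 ?(ltW x0)// lerDl.
have cf := is_derive_continuous fd.
have := @pint_near_primitive R (fun t => f t * dirichlet N t) F dF (12 * B / nu).
rewrite F0 Fp !subr0; apply=> //.
- by move=> x; apply: cvgM; [exact: cf|exact: continuous_dirichlet].
move=> x; rewrite in_itv/= => /bnd[d [d0 ds dx d2 [f1b fb]]].
have s0 : 0 < sin (x / 2) by rewrite (lt_le_trans _ ds)// divr_gt0.
have -> : dF x - f x * dirichlet N x = - (q1 x * (cos (x * nu) / nu)).
  by rewrite /dF -dirichlet_sin; field; rewrite !gt_eqF.
rewrite normrN normrM; apply: ler_pM => //; last first.
  by rewrite normrM normfV (gtr0_norm nu0) ler_piMl ?invr_ge0 ?(ltW nu0)// cos_max.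
have i4 : (sin (x / 2))^-1 <= 4 / d.
  rewrite -[leLHS]mul1r ler_pdivrMr// mulrAC ler_pdivlMr// mul1r.
  by rewrite mulrC -ler_pdivrMr.
have i0 : 0 <= (sin (x / 2))^-1 by rewrite invr_ge0 ltW.
rewrite /q1; apply: le_trans (ler_normB _ _) _.
have -> : 12 * B = B * d * (4 / d) + B * d ^+ 2 * 2^-1 * (4 / d) ^+ 2.
  by field; rewrite gt_eqF.
apply: lerD.
  by rewrite normrM ler_pM// normfV gtr0_norm.
rewrite normrM normfV normrX (gtr0_norm s0) -exprVn normrM.
apply: ler_pM => //; first by rewrite exprn_ge0.
  apply: ler_pM => //; rewrite normrM normfV (gtr0_norm (_ : 0 < 2))//.
  by rewrite ler_piMl// cos_max.
by apply: lerXn2r; rewrite // nnegrE// divr_ge0// ltW.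
Unshelve. all: by end_near.
Qed.

(** Subtracting f 0 + f1 0 sin t from f creates the double zeros of the previous
    lemma; the kernel has integral 2 pi and is orthogonal to the sine.  The
    constant comes from 12 / (N + 1/2) <= 24 / (N + 1). *)
Lemma dirichlet_rate f f1 f2 (B1 B2 : R) (N : nat) :
  (forall x : R, is_derive x 1 f (f1 x)) ->
  (forall x : R, is_derive x 1 f1 (f2 x)) ->
  (forall x, `|f1 x| <= B1) -> (forall x, `|f2 x| <= B2) ->
  f (2 * pi) = f 0 -> f1 (2 * pi) = f1 0 ->
  `|f 0 - (2 * pi)^-1 * pint (fun t => f t * dirichlet N t)|
     <= 24 * (B1 + B2) / N.+1%:R.
Proof.
move=> fd f1d f1B f2B fp f1p.
have p0 := @twopi_gt0 R.
pose g x := f x - f 0 - f1 0 * sin x.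
pose g1 x := f1 x - f1 0 * cos x.
pose g2 x := f2 x + f1 0 * sin x.
have gd (x : R) : is_derive x 1 g (g1 x).
  have h1 := @is_deriveB _ _ _ _ _ _ _ _ _ (fd x) (is_derive_cst (f 0) x 1).
  have h2 := @is_deriveZ _ _ _ _ (f1 0) _ _ _ (is_derive_sin x).
  have := @is_deriveB _ _ _ _ _ _ _ _ _ h1 h2.
  by move/is_derive_eq; apply; rewrite subr0.
have g1d (x : R) : is_derive x 1 g1 (g2 x).
  have h2 := @is_deriveZ _ _ _ _ (f1 0) _ _ _ (is_derive_cos x).
  have := @is_deriveB _ _ _ _ _ _ _ _ _ (f1d x) h2.
  by move/is_derive_eq; apply; rewrite /g2 /GRing.scale /=; ring.
have g2B x : `|g2 x| <= B1 + B2.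
  rewrite addrC; apply: le_trans (ler_normD _ _) _; apply: lerD => //.
  rewrite normrM; apply: le_trans (f1B 0).
  by rewrite ler_piMr// sin_max.
have s2 : sin (2 * pi) = 0 :> R by rewrite mulr_natl sin2pi.
have c2 : cos (2 * pi) = 1 :> R by rewrite mulr_natl cos2pi.
have g0 : g 0 = 0 by rewrite /g sin0; ring.
have g10 : g1 0 = 0 by rewrite /g1 cos0; ring.
have gp : g (2 * pi) = 0 by rewrite /g s2 fp; ring.
have g1p : g1 (2 * pi) = 0 by rewrite /g1 c2 f1p; ring.
have := @pint_dirichlet_double_zero g g1 g2 (B1 + B2) N gd g1d g2B g0 g10 gp g1p.
rewrite /g.
have cf := is_derive_continuous fd.
have cD := @continuous_dirichlet R N.
have -> : (fun t => (f t - f 0 - f1 0 * sin t) * dirichlet N t) =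
  (fun t => f t * dirichlet N t + (- f 0 * dirichlet N t +
      - f1 0 * (sin t * dirichlet N t))).
  by apply/funext => t; ring.
have cfD : continuous (fun t => f t * dirichlet N t).
  by move=> t; apply: cvgM; [exact: cf|exact: cD].
have csD : continuous (fun t : R => sin t * dirichlet N t).
  by move=> t; apply: cvgM; [exact: continuous_sin|exact: cD].
have c0D : continuous (fun t : R => - f 0 * dirichlet N t).
  by move=> t; apply: cvgM; [exact: cvg_cst|exact: cD].
have c1D : continuous (fun t : R => - f1 0 * (sin t * dirichlet N t)).
  by move=> t; apply: cvgM; [exact: cvg_cst|exact: csD].
rewrite pintD//; last by move=> t; apply: cvgD; [exact: c0D|exact: c1D].
rewrite pintD// !pintZ// pint_dirichlet pint_sin_dirichlet mulr0 addr0.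
move=> H.
have E (p a b : R) : p != 0 -> a - p^-1 * b = - (p^-1 * (b + - a * p)).
  by move=> p_neq0; field.
rewrite E ?gt_eqF// normrN normrM normfV (gtr0_norm p0) mulrC ler_pdivrMr//.
apply: le_trans H _; rewrite ler_wpM2r ?(ltW p0)//.
have BB : 0 <= B1 + B2 by apply: le_trans (g2B 0); exact: normr_ge0.
rewrite ler_pdivrMr ?ltr_wpDl// mulrAC ler_pdivlMr ?ltr0n//.
have -> : 12 * (B1 + B2) * N.+1%:R = (B1 + B2) * (12 * N.+1%:R) by ring.
have -> : 24 * (B1 + B2) * (N%:R + 2^-1) = (B1 + B2) * (24 * (N%:R + 2^-1)) by ring.
rewrite ler_wpM2l// -natr1.
have : 0 <= N%:R :> R by [].
lra.
Qed.

End DirichletBound.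

(** * Complex-valued functions of a real variable *)

Local Open Scope complex_scope.

Section ComplexLine.
Variable R : realType.
Notation Re := (@complex.Re R).
Notation Im := (@complex.Im R).
Implicit Types (f g F : R -> R[i]) (z w : R[i]).

Lemma cReD z w : Re (z + w) = Re z + Re w.
Proof. by case: z w => [a b] [c d]. Qed.
Lemma cImD z w : Im (z + w) = Im z + Im w.
Proof. by case: z w => [a b] [c d]. Qed.
Lemma cReM z w : Re (z * w) = Re z * Re w - Im z * Im w.
Proof. by case: z w => [a b] [c d]. Qed.
Lemma cImM z w : Im (z * w) = Re z * Im w + Im z * Re w.
Proof. by case: z w => [a b] [c d]. Qed.
Lemma cReN z : Re (- z) = - Re z.
Proof. by case: z. Qed.
Lemma cImN z : Im (- z) = - Im z.
Proof. by case: z. Qed.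

Lemma complex_ext z w : Re z = Re w -> Im z = Im w -> z = w.
Proof. by case: z w => [a b] [c d] /= -> ->. Qed.

Lemma cRe_sum (I : Type) (r : seq I) (P : pred I) (f : I -> R[i]) :
  Re (\sum_(i <- r | P i) f i) = \sum_(i <- r | P i) Re (f i).
Proof. by elim/big_rec2: _ => //= i y z _ <-; rewrite cReD. Qed.
Lemma cIm_sum (I : Type) (r : seq I) (P : pred I) (f : I -> R[i]) :
  Im (\sum_(i <- r | P i) f i) = \sum_(i <- r | P i) Im (f i).
Proof. by elim/big_rec2: _ => //= i y z _ <-; rewrite cImD. Qed.

Lemma normc_ge0 z : 0 <= normc z.
Proof. by case: z => a b; exact: sqrtr_ge0. Qed.

Lemma normc0 : normc (0 : R[i]) = 0.
Proof. exact: ComplexField.Normc.normc0. Qed.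

Lemma normcM z w : normc (z * w) = normc z * normc w.
Proof. exact: ComplexField.Normc.normcM. Qed.

Lemma normcD z w : normc (z + w) <= normc z + normc w.
Proof. exact: le_normcD. Qed.

Lemma normcN z : normc (- z) = normc z.
Proof. exact: normcN. Qed.

Lemma normcB z w : normc (z - w) <= normc z + normc w.
Proof. by rewrite -(normcN w); exact: normcD. Qed.

Lemma normc_real (x : R) : normc x%:C = `|x|.
Proof. by rewrite /= expr0n /= addr0 sqrtr_sqr. Qed.

Lemma normcX z n : normc (z ^+ n) = normc z ^+ n.
Proof.
elim: n => [|n IH]; first exact: ComplexField.Normc.normc1.
by rewrite !exprS normcM IH.
Qed.

Lemma normc_Re z : `|Re z| <= normc z.
Proof. by case: z => a b /=; rewrite -sqrtr_sqr ler_sqrt ?addr_ge0 ?sqr_ge0// lerDl sqr_ge0. Qed.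

Lemma normc_Im z : `|Im z| <= normc z.
Proof. by case: z => a b /=; rewrite -sqrtr_sqr ler_sqrt ?addr_ge0 ?sqr_ge0// lerDr sqr_ge0. Qed.

Lemma normc_ReIm z : normc z <= `|Re z| + `|Im z|.
Proof.
case: z => a b /=; rewrite -(ger0_norm (addr_ge0 (normr_ge0 a) (normr_ge0 b))).
rewrite -sqrtr_sqr ler_sqrt ?sqr_ge0// sqrrD !real_normK ?num_real//.
by rewrite lerD2r lerDl mulrn_wge0// mulr_ge0.
Qed.

Lemma normc_sum (I : Type) (r : seq I) (P : pred I) (f : I -> R[i]) :
  normc (\sum_(i <- r | P i) f i) <= \sum_(i <- r | P i) normc (f i).
Proof.
elim/big_rec2: _ => [|i x y _ H]; first by rewrite normc0.
by apply: le_trans (normcD _ _) _; rewrite lerD2l.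
Qed.

Lemma normc_eq0 z : normc z = 0 -> z = 0.
Proof. exact: ComplexField.Normc.eq0_normc. Qed.

Lemma expiD (x y : R) : expi (x + y) = expi x * expi y.
Proof.
apply: complex_ext; rewrite ?cReM ?cImM /=; first exact: cosD.
by rewrite sinD; ring.
Qed.

Lemma expi0 : expi 0 = 1 :> R[i].
Proof. by rewrite /expi cos0 sin0. Qed.

Lemma expiN (x : R) : expi (- x) * expi x = 1.
Proof. by rewrite -expiD addNr expi0. Qed.

Lemma normc_expi (x : R) : normc (expi x) = 1.
Proof. by rewrite /= cos2Dsin2 sqrtr1. Qed.

Lemma expi_2pi_int (n : int) (x : R) : expi (x + 2 * pi * n%:~R) = expi x.
Proof. by rewrite /expi cos_2pi_int sin_2pi_int. Qed.

(** Derivatives and continuity are taken on the real and imaginary parts, as in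
    the definition of pderive. *)
Definition cder f (x : R) (l : R[i]) : Prop :=
  is_derive x 1 (fun t => Re (f t)) (Re l) /\
  is_derive x 1 (fun t => Im (f t)) (Im l).

Definition ccont (T : topologicalType) (f : T -> R[i]) : Prop :=
  continuous (fun t => Re (f t)) /\ continuous (fun t => Im (f t)).

Lemma cder_eq f x l l' : cder f x l -> l = l' -> cder f x l'.
Proof. by move=> H <-. Qed.

Lemma cder_ccont f (df : R -> R[i]) :
  (forall x, cder f x (df x)) -> ccont f.
Proof.
move=> H; split.
  by apply: (@is_derive_continuous _ _ (fun x => Re (df x))) => x; exact: (H x).1.
by apply: (@is_derive_continuous _ _ (fun x => Im (df x))) => x; exact: (H x).2.
Qed.

Lemma cder_cst (c : R[i]) x : cder (fun=> c) x 0.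
Proof. by split; exact: is_derive_cst. Qed.

Lemma cderD f g x l l' : cder f x l -> cder g x l' ->
  cder (fun t => f t + g t) x (l + l').
Proof.
move=> [f1 f2] [g1 g2]; split.
  rewrite cReD (_ : (fun t => _) = (fun t => Re (f t)) + (fun t => Re (g t))).
    exact: is_deriveD.
  by apply/funext => t; rewrite cReD.
rewrite cImD (_ : (fun t => _) = (fun t => Im (f t)) + (fun t => Im (g t))).
  exact: is_deriveD.
by apply/funext => t; rewrite cImD.
Qed.

Lemma cderM f g x l l' : cder f x l -> cder g x l' ->
  cder (fun t => f t * g t) x (l * g x + f x * l').
Proof.
move=> [f1 f2] [g1 g2]; split.
  rewrite (_ : (fun t => _) = (fun t => Re (f t)) * (fun t => Re (g t))
      - (fun t => Im (f t)) * (fun t => Im (g t))).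
    apply: is_derive_eq.
    by rewrite cReD !cReM /GRing.scale /=; ring.
  by apply/funext => t; rewrite cReM.
rewrite (_ : (fun t => _) = (fun t => Re (f t)) * (fun t => Im (g t))
    + (fun t => Im (f t)) * (fun t => Re (g t))).
  apply: is_derive_eq.
  by rewrite cImD !cImM /GRing.scale /=; ring.
by apply/funext => t; rewrite cImM.
Qed.

Lemma cderZ (c : R[i]) f x l : cder f x l -> cder (fun t => c * f t) x (c * l).
Proof.
by move=> fl; apply: cder_eq (cderM (cder_cst c x) fl) _; rewrite mul0r add0r.
Qed.

Lemma cder_expi (c x : R) :
  cder (fun t => expi (t * c)) x ((0 +i* c) * expi (x * c)).
Proof.
split; rewrite ?cReM ?cImM /= mul0r.
  by rewrite sub0r; exact: is_derive_cosM.
by rewrite add0r; exact: is_derive_sinM.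
Qed.

Lemma ccontM (T : topologicalType) (f g : T -> R[i]) :
  ccont f -> ccont g -> ccont (fun t => f t * g t).
Proof.
move=> [f1 f2] [g1 g2]; split.
  under eq_fun do rewrite cReM.
  by move=> x; apply: cvgB; apply: cvgM; [exact: f1|exact: g1|exact: f2|exact: g2].
under eq_fun do rewrite cImM.
by move=> x; apply: cvgD; apply: cvgM; [exact: f1|exact: g2|exact: f2|exact: g1].
Qed.

Lemma ccontD (T : topologicalType) (f g : T -> R[i]) :
  ccont f -> ccont g -> ccont (fun t => f t + g t).
Proof.
move=> [f1 f2] [g1 g2]; split.
  under eq_fun do rewrite cReD.
  by move=> x; apply: cvgD; [exact: f1|exact: g1].
under eq_fun do rewrite cImD.
by move=> x; apply: cvgD; [exact: f2|exact: g2].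
Qed.

Lemma ccont_cst (T : topologicalType) (c : R[i]) : ccont (fun _ : T => c).
Proof. by split=> x; exact: cvg_cst. Qed.

Lemma ccont_expi (c : R) : ccont (fun t : R => expi (t * c)).
Proof. exact: (cder_ccont (cder_expi c)). Qed.

Definition cint f : R[i] := pint (fun t => Re (f t)) +i* pint (fun t => Im (f t)).

Lemma cintD f g : ccont f -> ccont g ->
  cint (fun t => f t + g t) = cint f + cint g.
Proof.
move=> [f1 f2] [g1 g2]; apply: complex_ext; rewrite ?cReD ?cImD /= -pintD//.
  by congr pint; apply/funext => t; rewrite cReD.
by congr pint; apply/funext => t; rewrite cImD.
Qed.

Lemma cintZ (c : R[i]) f : ccont f -> cint (fun t => c * f t) = c * cint f.
Proof.
move=> [f1 f2]; have cZ (a : R) (h : R -> R) : continuous h -> continuous (fun t => a * h t).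
  by move=> ch t; apply: cvgM; [exact: cvg_cst|exact: ch].
apply: complex_ext; rewrite ?cReM ?cImM /=.
  rewrite -mulNr -!pintZ// -pintD; [|exact: cZ|exact: cZ].
  by congr pint; apply/funext => t; rewrite cReM mulNr.
rewrite -!pintZ// -pintD; [|exact: cZ|exact: cZ].
by congr pint; apply/funext => t; rewrite cImM.
Qed.

(** The factor 2 comes from estimating the real and imaginary parts
    separately. *)
Lemma cint_bound f (B : R) : ccont f -> (forall t, normc (f t) <= B) ->
  normc (cint f) <= 2 * B * (2 * pi).
Proof.
move=> [f1 f2] fB; apply: le_trans (normc_ReIm _) _ => /=.
rewrite -mulrA mulr_natl mulr2n; apply: lerD; apply: pint_bound => // t.
  exact: le_trans (normc_Re _) (fB t).
exact: le_trans (normc_Im _) (fB t).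
Qed.

Lemma cint_derive F f : (forall x, cder F x (f x)) -> ccont f ->
  cint f = F (2 * pi) - F 0.
Proof.
move=> Fd [f1 f2]; apply: complex_ext; rewrite ?cReD ?cImD ?cReN ?cImN /=.
  by apply: (@pint_derive _ (fun t => Re (F t))) => // x; exact: (Fd x).1.
by apply: (@pint_derive _ (fun t => Im (F t))) => // x; exact: (Fd x).2.
Qed.

Lemma cint_under_diff (F F1 : R -> R -> R[i]) (B t0 : R) :
  (forall t, ccont (F t)) -> (forall t, ccont (F1 t)) ->
  (forall t a, cder (F ^~ a) t (F1 t a)) ->
  (forall t a, normc (F1 t a) <= B) ->
  cder (fun t => cint (F t)) t0 (cint (F1 t0)).
Proof.
move=> cF cF1 FF1 F1B; split.
  apply: (@pint_under_diff _ (fun t a => Re (F t a)) (fun t a => Re (F1 t a)) B).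
  - by move=> t; exact: (cF t).1.
  - by move=> t; exact: (cF1 t).1.
  - by move=> t a; exact: (FF1 t a).1.
  - by move=> t a; apply: le_trans (normc_Re _) (F1B t a).
apply: (@pint_under_diff _ (fun t a => Im (F t a)) (fun t a => Im (F1 t a)) B).
- by move=> t; exact: (cF t).2.
- by move=> t; exact: (cF1 t).2.
- by move=> t a; exact: (FF1 t a).2.
- by move=> t a; apply: le_trans (normc_Im _) (F1B t a).
Qed.

Lemma cint_shift f (df : R -> R[i]) (B x : R) :
  (forall y, cder f y (df y)) -> ccont df ->
  (forall y, normc (df y) <= B) -> (forall y, f (y + 2 * pi) = f y) ->
  cint (fun a => f (x + a)) = cint f.
Proof.
move=> fd [c1 c2] dB fp; apply: complex_ext => /=.
  apply: (@pint_shift _ (fun t => Re (f t)) (fun t => Re (df t)) B) => //.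
  - by move=> y; exact: (fd y).1.
  - by move=> y; apply: le_trans (normc_Re _) (dB y).
  - by move=> y; rewrite fp.
apply: (@pint_shift _ (fun t => Im (f t)) (fun t => Im (df t)) B) => //.
- by move=> y; exact: (fd y).2.
- by move=> y; apply: le_trans (normc_Im _) (dB y).
- by move=> y; rewrite fp.
Qed.

Lemma freq_rev N (i : nat) : (i < N.*2.+1)%N ->
  freq N (N.*2.+1 - i.+1) = - freq N i.
Proof.
by move=> iN; rewrite /freq subSS -subzn// -addnn PoszD; ring.
Qed.

(** The sines of opposite frequencies cancel. *)
Lemma dirichlet_expi N (t : R) :
  \sum_(i < N.*2.+1) expi (t * (freq N i)%:~R) = (dirichlet N t)%:C.
Proof.
apply: complex_ext; rewrite ?cRe_sum ?cIm_sum//=.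
apply/eqP; rewrite -[_ == 0](mulrn_eq0 _ 2) mulr2n; apply/eqP.
rewrite {1}(reindex_inj rev_ord_inj)/= -big_split big1//= => i _.
by rewrite freq_rev// intrN mulrN sinN addNr.
Qed.

Lemma fourier_rate f f1 f2 (B1 B2 : R) (N : nat) :
  (forall x, cder f x (f1 x)) -> (forall x, cder f1 x (f2 x)) ->
  (forall x, normc (f1 x) <= B1) -> (forall x, normc (f2 x) <= B2) ->
  f (2 * pi) = f 0 -> f1 (2 * pi) = f1 0 ->
  normc (f 0 - ((2 * pi)^-1)%:C *
      cint (fun t => f t * \sum_(i < N.*2.+1) expi (t * (freq N i)%:~R)))
     <= 48 * (B1 + B2) / N.+1%:R.
Proof.
move=> fd f1d f1B f2B fp f1p; apply: le_trans (normc_ReIm _) _.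
have -> : 48 * (B1 + B2) / N.+1%:R = 24 * (B1 + B2) / N.+1%:R + 24 * (B1 + B2) / N.+1%:R.
  by ring.
apply: lerD.
  rewrite cReD cReN cReM /= mul0r subr0.
  under [X in pint X]eq_fun => t do rewrite dirichlet_expi cReM /= mulr0 subr0.
  apply: (@dirichlet_rate _ (fun t => Re (f t)) (fun t => Re (f1 t)) (fun t => Re (f2 t))).
  - by move=> x; exact: (fd x).1.
  - by move=> x; exact: (f1d x).1.
  - by move=> x; apply: le_trans (normc_Re _) (f1B x).
  - by move=> x; apply: le_trans (normc_Re _) (f2B x).
  - by rewrite fp.
  - by rewrite f1p.
rewrite cImD cImN cImM /= mul0r addr0.
under [X in pint X]eq_fun => t do rewrite dirichlet_expi cImM /= mulr0 add0r.
apply: (@dirichlet_rate _ (fun t => Im (f t)) (fun t => Im (f1 t)) (fun t => Im (f2 t))).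
- by move=> x; exact: (fd x).2.
- by move=> x; exact: (f1d x).2.
- by move=> x; apply: le_trans (normc_Im _) (f1B x).
- by move=> x; apply: le_trans (normc_Im _) (f2B x).
- by rewrite fp.
- by rewrite f1p.
Qed.

End ComplexLine.

(** * Smooth functions on the torus *)

Arguments pderive : simpl never.
Arguments Dj : simpl never.

Section PartialDerivatives.
Variables (R : realType) (d : nat).
Notation Re := (@complex.Re R).
Notation Im := (@complex.Im R).
Implicit Types (f g : 'rV[R]_d -> R[i]) (x y z : 'rV[R]_d) (j k : 'I_d).

Definition upd (x : 'rV[R]_d) (j : 'I_d) (t : R) : 'rV[R]_d :=
  \row_k (if k == j then t else x 0 k).

Lemma updE x j t k : upd x j t 0 k = if k == j then t else x 0 k.
Proof. by rewrite mxE. Qed.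

Lemma upd_upd x j s t : upd (upd x j s) j t = upd x j t.
Proof. by apply/rowP => k; rewrite !updE; case: eqP. Qed.

Lemma updC x j k s t : j != k -> upd (upd x j s) k t = upd (upd x k t) j s.
Proof.
move=> jk; apply/rowP => i; rewrite !updE.
by case: eqP => // ->; rewrite eq_sym (negbTE jk).
Qed.

Lemma upd_id x j : upd x j (x 0 j) = x.
Proof. by apply/rowP => k; rewrite updE; case: eqP => // ->. Qed.

Lemma upd_delta x j (h : R) : h *: delta_mx 0 j + x = upd x j (h + x 0 j).
Proof.
apply/rowP => k; rewrite !mxE eqxx /=; case: eqP => [->|_]; first by rewrite mulr1.
by rewrite mulr0 add0r.
Qed.

(** Partial derivatives are one-variable derivatives along coordinate lines;
    this transfers the calculus of the real line to the torus. *)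
Lemma is_derive_upd (f : 'rV[R]_d -> R) x j (l : R) :
  is_derive x (delta_mx 0 j) f l <->
  is_derive (x 0 j) 1 (fun t => f (upd x j t)) l.
Proof.
have E : (fun h : R => h^-1 *: ((f \o shift x) (h *: delta_mx 0 j) - f x)) =
  (fun h : R => h^-1 *: (((fun t => f (upd x j t)) \o shift (x 0 j)) (h *: 1)
     - f (upd x j (x 0 j)))).
  by apply/funext => h; rewrite /= upd_delta upd_id /GRing.scale /= mulr1.
split=> -[d1 d2]; apply: DeriveDef.
- by move: d1; rewrite /derivable E.
- by move: d2; rewrite /derive E.
- by rewrite /derivable E; exact: d1.
- by rewrite /derive E; exact: d2.
Qed.

Definition has_pd j f x (l : R[i]) : Prop :=
  cder (fun t => f (upd x j t)) (x 0 j) l.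

Lemma has_pdP j f x l :
  has_pd j f x l <-> pderivable j f x /\ pderive j f x = l.
Proof.
have HR := is_derive_upd (fun y => Re (f y)) x j.
have HI := is_derive_upd (fun y => Im (f y)) x j.
split=> [[/HR[h1 h2] /HI[h3 h4]]|[[h1 h2] <-]].
  split; [by split; [exact: h1|exact: h3]|apply: complex_ext; [exact: h2|exact: h4]].
split; [apply/HR; exact: (derivableP h1)|apply/HI; exact: (derivableP h2)].
Qed.

Lemma has_pd_slice j f (g : 'rV[R]_d -> R[i]) : (forall x, has_pd j f x (g x)) ->
  forall z t, cder (fun t => f (upd z j t)) t (g (upd z j t)).
Proof.
move=> H z t; have := H (upd z j t); rewrite /has_pd updE eqxx.
by congr (cder _ _ _); apply/funext => s; rewrite upd_upd.
Qed.

Lemma upd_sub_bound j f (g : 'rV[R]_d -> R[i]) (B : R) :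
  (forall x, has_pd j f x (g x)) -> (forall x, normc (g x) <= B) ->
  forall z s t, normc (f (upd z j t) - f (upd z j s)) <= 2 * B * `|t - s|.
Proof.
move=> /has_pd_slice fd gB z s t; apply: le_trans (normc_ReIm _) _.
have -> : 2 * B * `|t - s| = B * `|t - s| + B * `|t - s| by ring.
rewrite cReD cReN cImD cImN; apply: lerD.
  apply: (@derive_bound _ (fun t => Re (f (upd z j t))) (fun t => Re (g (upd z j t)))).
    by move=> u; exact: (fd z u).1.
  by move=> u; apply: le_trans (normc_Re _) (gB _).
apply: (@derive_bound _ (fun t => Im (f (upd z j t))) (fun t => Im (g (upd z j t)))).
  by move=> u; exact: (fd z u).2.
by move=> u; apply: le_trans (normc_Im _) (gB _).
Qed.

Lemma coord_le_norm x j : `|x 0 j| <= `|x|.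
Proof. by rewrite [leRHS]/Num.norm /= mx_normrE; apply/bigmax_geP; right => /=; exists (0, j). Qed.

(** The path from x to y changes one coordinate at a time. *)
Lemma lipschitz_of_pd f (g : 'I_d -> 'rV[R]_d -> R[i]) (B : R) :
  (forall j x, has_pd j f x (g j x)) -> (forall j x, normc (g j x) <= B) ->
  0 <= B -> forall x y, normc (f y - f x) <= 2 * B * d%:R * `|y - x|.
Proof.
move=> fd gB B0 x y.
pose mix (l : seq 'I_d) := \row_k (if k \in l then y 0 k else x 0 k).
have -> : f y = f (mix (enum 'I_d)).
  by congr f; apply/rowP => k; rewrite mxE mem_enum.
suff H l : normc (f (mix l) - f x) <= 2 * B * (size l)%:R * `|y - x|.
  by apply: le_trans (H _) _; rewrite size_enum_ord.
elim: l => [|j l IH].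
  have -> : mix [::] = x by apply/rowP => k; rewrite mxE.
  by rewrite subrr normc0 mulr0 mul0r.
have -> : mix (j :: l) = upd (mix l) j (y 0 j).
  by apply/rowP => k; rewrite !mxE in_cons; case: eqP => // ->.
have -> : f (upd (mix l) j (y 0 j)) - f x =
   (f (upd (mix l) j (y 0 j)) - f (upd (mix l) j (mix l 0 j))) + (f (mix l) - f x).
  by rewrite upd_id addrA subrK.
apply: le_trans (normcD _ _) _; rewrite /= -[(size l).+1%:R]nat1r mulrDr mulr1 mulrDl.
apply: lerD => //; apply: le_trans (upd_sub_bound (fd j) (gB j) _ _ _) _.
rewrite ler_wpM2l ?mulr_ge0//; have := coord_le_norm (y - x) j; rewrite !mxE.
by apply: le_trans; case: ifP => // _; rewrite subrr normr0.
Qed.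

Lemma lipschitz_ccont f (K : R) :
  (forall x y, normc (f y - f x) <= K * `|y - x|) -> ccont f.
Proof.
move=> fK.
have H (h : 'rV[R]_d -> R) :
    (forall x y, `|h y - h x| <= normc (f y - f x)) -> continuous h.
  move=> hf x.
  apply/(@cvgrPdist_le R R^o _ (nbhs x) (nbhs_filter x) h (h x)) => e e0; near=> y.
  rewrite distrC; apply: le_trans (hf _ _) _; apply: le_trans (fK _ _) _.
  apply: (@le_trans _ _ ((`|K| + 1) * `|y - x|)).
    by rewrite ler_wpM2r// (le_trans (ler_norm _))// lerDl.
  rewrite mulrC -ler_pdivlMr ?ltr_wpDl// distrC.
  near: y; apply: (@cvgr_dist_le _ _ _ _ (nbhs_filter x) id x cvg_id).
  by rewrite divr_gt0// ltr_wpDl.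
split; apply: H => x y.
  by rewrite -cReN -cReD; exact: normc_Re.
by rewrite -cImN -cImD; exact: normc_Im.
Unshelve. all: by end_near.
Qed.

(** A coinduction principle.  Integrals, products and sums of smooth functions
    form classes of continuous functions stable under partial derivatives, so
    that they are smooth without computing their iterated derivatives. *)
Lemma smooth_class (C : ('rV[R]_d -> R[i]) -> Prop) :
  (forall f, C f -> ccont f) ->
  (forall f, C f -> forall j, exists2 g, C g & forall x, has_pd j f x (g x)) ->
  forall f, C f -> smooth f.
Proof.
move=> C1 C2 f Cf w.
have Cw : C (foldr (@pderive R d) f w).
  elim: w => [//|j w IH] /=; have [g Cg H] := C2 _ IH j.
  rewrite (_ : pderive j _ = g)//.
  by apply/funext => x; have /has_pdP[] := H x.
split; [exact: (C1 _ Cw).1|exact: (C1 _ Cw).2|].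
by move=> j x; have [g Cg H] := C2 _ Cw j; have /has_pdP[] := H x.
Qed.

Definition tsmooth f : Prop := torus_periodic f /\ smooth f.

Lemma tsmooth_ccont f : tsmooth f -> ccont f.
Proof. by move=> [_ /(_ [::])[h1 h2 _]]. Qed.

Lemma tsmooth_pd j f x : tsmooth f -> has_pd j f x (pderive j f x).
Proof. by move=> [_ /(_ [::])[_ _ h]]; apply/has_pdP; split=> //; exact: h. Qed.

Lemma derive_periodic (h : 'rV[R]_d -> R) (p v x : 'rV[R]_d) :
  (forall y, h (y + p) = h y) -> 'D_v h (x + p) = 'D_v h x.
Proof.
move=> hp; rewrite /derive.
suff -> : (fun t : R => t^-1 *: ((h \o shift (x + p)) (t *: v) - h (x + p))) =
          (fun t : R => t^-1 *: ((h \o shift x) (t *: v) - h x)) by [].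
by apply/funext => t /=; rewrite addrA !hp.
Qed.

Lemma tsmooth_pderive j f : tsmooth f -> tsmooth (pderive j f).
Proof.
move=> [fp fs]; split.
  by move=> x k; rewrite /pderive !derive_periodic// => y; rewrite fp.
by move=> w; have := fs (rcons w j); rewrite foldr_rcons.
Qed.

Lemma tsmooth_class (C : ('rV[R]_d -> R[i]) -> Prop) :
  (forall f, C f -> torus_periodic f) -> (forall f, C f -> ccont f) ->
  (forall f, C f -> forall j, exists2 g, C g & forall x, has_pd j f x (g x)) ->
  forall f, C f -> tsmooth f.
Proof.
by move=> C0 C1 C2 f Cf; split; [exact: C0|exact: smooth_class C1 C2 _ Cf].
Qed.

(** Every point is congruent to a point of the compact cube [0, 2 pi]^d. *)
Lemma torus_bounded f : torus_periodic f -> ccont f ->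
  exists2 B : R, 0 <= B & forall x, normc (f x) <= B.
Proof.
move=> fp [c1 c2]; have p0 := @twopi_gt0 R.
pose K := [set v : 'rV[R]_d | forall i, `[0, 2 * pi]%classic (v 0 i)].
have cK : compact K.
  by apply: (@rV_compact R d (fun=> `[0, 2 * pi]%classic)) => i; exact: segment_compact.
have bnd (h : 'rV[R]_d -> R) : continuous h ->
    exists2 B : R, 0 <= B & forall x, K x -> `|h x| <= B.
  move=> ch.
  have /compact_bounded[M [_ HM]] :=
    continuous_compact (continuous_subspaceT ch) cK.
  exists (`|M| + 1); first by rewrite addr_ge0.
  move=> x Kx; apply: (HM (`|M| + 1)); last by exists x.
  by rewrite (le_lt_trans (ler_norm _))// ltrDl.
have [B1 B10 H1] := bnd _ c1; have [B2 B20 H2] := bnd _ c2.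
exists (B1 + B2); first exact: addr_ge0.
move=> x.
(* k translates x into the cube *)
pose k : 'rV[int]_d := \row_i - Num.floor (x 0 i / (2 * pi)).
rewrite -(fp x k); set y := _ + _.
have Ky : K y.
  move=> i; rewrite /= in_itv/= !mxE mulrNz mulrN subr_ge0 lerBlDr.
  set q := x 0 i / (2 * pi).
  have -> : x 0 i = 2 * pi * q by rewrite /q mulrCA divff ?mulr1 ?gt_eqF.
  apply/andP; split; first by rewrite ler_pM2l// floor_le.
  by rewrite -[X in X + _](mulr1 (2 * pi)) -mulrDr ler_pM2l// addrC ltW// (lt_le_trans (floorD1_gt _))// intrD.
by apply: le_trans (normc_ReIm _) _; apply: lerD; [exact: H1|exact: H2].
Qed.

Lemma tsmooth_bounded f : tsmooth f ->
  exists2 B : R, 0 <= B & forall x, normc (f x) <= B.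
Proof. by move=> fs; apply: torus_bounded; [exact: fs.1|exact: tsmooth_ccont]. Qed.

Lemma tsmooth_lin (a b : R[i]) f g : tsmooth f -> tsmooth g ->
  tsmooth (fun x => a * f x + b * g x).
Proof.
move=> fs gs.
pose C h := exists2 u, tsmooth u & exists2 v, tsmooth v &
  h = (fun x => a * u x + b * v x).
apply: (@tsmooth_class C) => [|||]; last by exists f => //; exists g.
- by move=> _ [u us [v vs ->]] x k; rewrite us.1 vs.1.
- move=> _ [u us [v vs ->]]; apply: ccontD; apply: ccontM => //;
    first [exact: ccont_cst|exact: tsmooth_ccont].
- move=> _ [u us [v vs ->]] j.
  exists (fun x => a * pderive j u x + b * pderive j v x).
    exact: (ex_intro2 _ _ _ (tsmooth_pderive j us)
      (ex_intro2 _ _ _ (tsmooth_pderive j vs) erefl)).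
  by move=> x; apply: cderD; apply: cderZ; exact: tsmooth_pd.
Qed.

Lemma pderive_lin j (a b : R[i]) f g x : tsmooth f -> tsmooth g ->
  pderive j (fun x => a * f x + b * g x) x = a * pderive j f x + b * pderive j g x.
Proof.
move=> fs gs; have /has_pdP[] // : has_pd j (fun x => a * f x + b * g x) x
  (a * pderive j f x + b * pderive j g x).
by apply: cderD; apply: cderZ; exact: tsmooth_pd.
Qed.

End PartialDerivatives.

(** * Fourier components in one variable *)

Section Projection.
Variables (R : realType) (d : nat).
Implicit Types (f g : 'rV[R]_d -> R[i]) (x y z : 'rV[R]_d) (j k : 'I_d).

(** The component of frequency - n in the variable j.  The sign is the one
    produced by pairing v e^{i x eta} with a test function: the integral is
    against e^{i x eta}, and the character e^{- i x eta} comes back from the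
    definition of the partial Fourier coefficient. *)
Definition eproj j (n : int) f z : R[i] :=
  ((2 * pi)^-1)%:C *
  (cint (fun a => f (upd z j a) * expi (a * n%:~R)) * expi (- (z 0 j * n%:~R))).

Arguments eproj : simpl never.

Lemma slice_ccont j f z : tsmooth f -> ccont (fun a => f (upd z j a)).
Proof.
move=> fs; apply: (@cder_ccont _ _ (fun a => pderive j f (upd z j a))) => t.
by apply: (@has_pd_slice _ _ j f (pderive j f)) => x; exact: tsmooth_pd.
Qed.

Lemma slice_expi_ccont j f z (c : R) : tsmooth f ->
  ccont (fun a => f (upd z j a) * expi (a * c)).
Proof. by move=> fs; apply: ccontM; [exact: slice_ccont|exact: ccont_expi]. Qed.

Lemma eproj_lin j n (a b : R[i]) f g z : tsmooth f -> tsmooth g ->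
  eproj j n (fun x => a * f x + b * g x) z = a * eproj j n f z + b * eproj j n g z.
Proof.
move=> fs gs; rewrite /eproj.
have cZ (c : R[i]) h : tsmooth h ->
    ccont (fun t => c * (h (upd z j t) * expi (t * n%:~R))).
  by move=> hs; apply: ccontM; [exact: ccont_cst|exact: slice_expi_ccont].
under [X in cint X]eq_fun => t.
  rewrite (_ : _ * _ = a * (f (upd z j t) * expi (t * n%:~R)) +
    b * (g (upd z j t) * expi (t * n%:~R))); last by ring.
  over.
rewrite cintD; [|exact: cZ|exact: cZ].
rewrite !cintZ; [ring|exact: slice_expi_ccont|exact: slice_expi_ccont].
Qed.

Lemma eproj_bound j n f (B : R) z : tsmooth f -> (forall x, normc (f x) <= B) ->
  normc (eproj j n f z) <= 2 * B.
Proof.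
move=> fs fB; have p0 := @twopi_gt0 R.
rewrite normcM normc_real normfV (gtr0_norm p0) normcM normc_expi mulr1.
rewrite mulrC ler_pdivrMr//; apply: cint_bound; first exact: slice_expi_ccont.
by move=> t; rewrite normcM normc_expi mulr1.
Qed.

Lemma periodic_upd j f x t : torus_periodic f ->
  f (upd x j (t + 2 * pi)) = f (upd x j t).
Proof.
move=> fp; rewrite -(fp (upd x j t) (delta_mx 0 j)); congr f.
apply/rowP => k; rewrite !mxE eqxx /=.
by case: eqP => _; rewrite ?mulr1 ?mulr0 ?addr0.
Qed.

Lemma eproj_pd_eq j n f z : tsmooth f ->
  has_pd j (eproj j n f) z ((0 -i* n%:~R) * eproj j n f z).
Proof.
move=> fs; rewrite /has_pd /eproj.
have E : (fun t => ((2 * pi)^-1)%:C *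
    (cint (fun a => f (upd (upd z j t) j a) * expi (a * n%:~R)) *
     expi (- (upd z j t 0 j * n%:~R)))) =
  (fun t => ((2 * pi)^-1)%:C *
    (cint (fun a => f (upd z j a) * expi (a * n%:~R)) * expi (t * - n%:~R))).
  apply/funext => t; rewrite updE eqxx mulrN; congr (_ * (cint _ * _)).
  by apply/funext => a; rewrite upd_upd.
rewrite E.
apply: cder_eq (cderZ _ (cderZ _ (cder_expi (- n%:~R) (z 0 j)))) _.
rewrite mulrN; ring.
Qed.

(** Integration by parts; the boundary terms cancel by periodicity. *)
Lemma eproj_by_parts j n f z : tsmooth f ->
  eproj j n (pderive j f) z = (0 -i* n%:~R) * eproj j n f z.
Proof.
move=> fs; rewrite /eproj.
have f's := tsmooth_pderive j fs.
suff -> : cint (fun a => pderive j f (upd z j a) * expi (a * n%:~R)) =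
    (0 -i* n%:~R) * cint (fun a => f (upd z j a) * expi (a * n%:~R)) by ring.
have -> : (0 -i* n%:~R) = - (0 +i* n%:~R) :> R[i] by rewrite /GRing.opp /= oppr0.
rewrite mulNr -cintZ; last exact: slice_expi_ccont.
apply/eqP; rewrite -subr_eq0 opprK -cintD; last first.
- by apply: ccontM; [exact: ccont_cst|exact: slice_expi_ccont].
- exact: slice_expi_ccont.
apply/eqP.
rewrite (@cint_derive _ (fun a => f (upd z j a) * expi (a * n%:~R))).
- rewrite -[2 * pi]add0r periodic_upd; last exact: fs.1.
  by rewrite add0r -[2 * pi * _]add0r expi_2pi_int mul0r subrr.
- move=> a; have H : cder (fun a => f (upd z j a)) a (pderive j f (upd z j a)).
    by apply: (@has_pd_slice _ _ j f (pderive j f)) => x; exact: tsmooth_pd.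
  apply: cder_eq (cderM H (cder_expi n%:~R a)) _; ring.
- apply: ccontD; first exact: slice_expi_ccont.
  by apply: ccontM; [exact: ccont_cst|exact: slice_expi_ccont].
Qed.

(** For k <> j the derivative passes under the integral; for k = j it falls on
    the character, and integration by parts gives the same value. *)
Lemma eproj_pd j n f k z : tsmooth f ->
  has_pd k (eproj j n f) z (eproj j n (pderive k f) z).
Proof.
move=> fs; have [->|kj] := eqVneq k j.
  by rewrite (eproj_by_parts j n z fs); exact: eproj_pd_eq.
have fks := tsmooth_pderive k fs.
rewrite /has_pd /eproj.
have E : (fun t => ((2 * pi)^-1)%:C *
    (cint (fun a => f (upd (upd z k t) j a) * expi (a * n%:~R)) *
     expi (- (upd z k t 0 j * n%:~R)))) =
  (fun t => (((2 * pi)^-1)%:C * expi (- (z 0 j * n%:~R))) *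
    cint (fun a => f (upd (upd z j a) k t) * expi (a * n%:~R))).
  apply/funext => t; rewrite updE eq_sym (negbTE kj).
  rewrite (_ : (fun a => f (upd (upd z k t) j a) * expi (a * n%:~R)) =
    (fun a => f (upd (upd z j a) k t) * expi (a * n%:~R))); first by ring.
  by apply/funext => a; rewrite updC.
have [B B0 fB] := tsmooth_bounded fks.
rewrite E.
have sE (h : 'rV[R]_d -> R[i]) t a :
   h (upd (upd z j a) k t) = h (upd (upd z k t) j a) by rewrite [in RHS]updC.
have H := @cint_under_diff R
  (fun t a => f (upd (upd z j a) k t) * expi (a * n%:~R))
  (fun t a => pderive k f (upd (upd z j a) k t) * expi (a * n%:~R)) B (z 0 k).
apply: cder_eq (cderZ _ (H _ _ _ _)) _.
- move=> t; under eq_fun do rewrite sE; exact: slice_expi_ccont.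
- move=> t; under eq_fun do rewrite sE; exact: slice_expi_ccont.
- move=> t a.
  have Hf : cder (fun t => f (upd (upd z j a) k t)) t (pderive k f (upd (upd z j a) k t)).
    by apply: (@has_pd_slice _ _ k f (pderive k f)) => x; exact: tsmooth_pd.
  by apply: cder_eq (cderM Hf (cder_cst _ _)) _; rewrite mulr0 addr0.
- by move=> t a; rewrite normcM normc_expi mulr1.
rewrite (_ : (fun a => pderive k f (upd (upd z j a) k (z 0 k)) * expi (a * n%:~R)) =
    (fun a => pderive k f (upd z j a) * expi (a * n%:~R))); first by ring.
by apply/funext => a; rewrite sE upd_id.
Qed.

Lemma tsmooth_pderive_bounded f : tsmooth f ->
  exists2 B : R, 0 <= B & forall k x, normc (pderive k f x) <= B.
Proof.
move=> fs.
have /choice[B HB] : forall k, exists B : R, 0 <= B /\ forall x, normc (pderive k f x) <= B.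
  by move=> k; have [B B0 H] := tsmooth_bounded (tsmooth_pderive k fs); exists B.
exists (\sum_k B k); first by apply: sumr_ge0 => k _; exact: (HB k).1.
move=> k x; apply: le_trans ((HB k).2 x) _.
by rewrite (bigD1 k)//= lerDl sumr_ge0// => i _; exact: (HB i).1.
Qed.

Lemma eproj_periodic j n f : torus_periodic f -> torus_periodic (eproj j n f).
Proof.
move=> fp z k; rewrite /eproj; congr (_ * (cint _ * _)).
  apply/funext => a; congr (_ * _).
  pose k' : 'rV[int]_d := \row_i (if i == j then 0 else k 0 i).
  rewrite -[RHS](fp _ k'); congr f; apply/rowP => i; rewrite !mxE.
  by case: eqP => _; rewrite ?mulr0z ?mulr0 ?addr0.
rewrite !mxE -[RHS](expi_2pi_int (- (k 0 j * n))) intrN intrM; congr expi; ring.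
Qed.

(** The components form a class stable under partial derivatives; they are
    continuous because these derivatives are bounded. *)
Lemma tsmooth_eproj j n f : tsmooth f -> tsmooth (eproj j n f).
Proof.
move=> fs; pose C h := exists2 u, tsmooth u & h = eproj j n u.
apply: (@tsmooth_class _ _ C) => [_ [u us ->]|_ [u us ->]|_ [u us ->] k|].
- by apply: eproj_periodic; exact: us.1.
- have [B B0 HB] := tsmooth_pderive_bounded us.
  apply: (@lipschitz_ccont _ _ _ (2 * (2 * B) * d%:R)).
  apply: (@lipschitz_of_pd _ _ _ (fun k => eproj j n (pderive k u))).
  + by move=> k x; exact: eproj_pd.
  + by move=> k x; exact: (eproj_bound j n x (tsmooth_pderive k us) (HB k)).
  + exact: mulr_ge0.
- exists (eproj j n (pderive k u)).
    exact: (ex_intro2 _ _ _ (tsmooth_pderive k us) erefl).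
  by move=> x; exact: eproj_pd.
- by exists f.
Qed.

Lemma pderive_eproj j n k f : tsmooth f ->
  pderive k (eproj j n f) = eproj j n (pderive k f).
Proof. by move=> fs; apply/funext => x; have /has_pdP[] := eproj_pd j n k x fs. Qed.

Lemma cint_sum (I : Type) (r : seq I) (f : I -> R -> R[i]) :
  (forall i, ccont (f i)) ->
  cint (fun t => \sum_(i <- r) f i t) = \sum_(i <- r) cint (f i).
Proof.
move=> cf; have cs s : ccont (fun t => \sum_(i <- s) f i t).
  elim: s => [|i s IH].
    by under eq_fun do rewrite big_nil; exact: ccont_cst.
  by under eq_fun do rewrite big_cons; exact: ccontD.
elim: r => [|i r IH].
  rewrite big_nil; under eq_fun do rewrite big_nil -[0](mul0r 0).
  by rewrite cintZ ?mul0r//; exact: ccont_cst.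
by rewrite big_cons -IH; under eq_fun do rewrite big_cons; rewrite cintD.
Qed.

(** With the integral centred at z, the characters of a partial sum add up to
    the Dirichlet kernel. *)
Lemma eproj_shift j n f z : tsmooth f ->
  eproj j n f z = ((2 * pi)^-1)%:C *
    cint (fun a => f (upd z j (z 0 j + a)) * expi (a * n%:~R)).
Proof.
move=> fs; rewrite /eproj; congr (_ * _).
pose G a := expi (- (z 0 j * n%:~R)) * (f (upd z j a) * expi (a * n%:~R)).
pose dG a := expi (- (z 0 j * n%:~R)) *
  (pderive j f (upd z j a) * expi (a * n%:~R) +
   f (upd z j a) * ((0 +i* n%:~R) * expi (a * n%:~R))).
rewrite mulrC -cintZ; last exact: slice_expi_ccont.
have [B B0 fB] := tsmooth_bounded fs.
have [B1 B10 f1B] := tsmooth_bounded (tsmooth_pderive j fs).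
rewrite -/G -(@cint_shift _ G dG (B1 + B * normc (0 +i* n%:~R)) (z 0 j)).
- congr cint; apply/funext => a; rewrite /G mulrCA -expiD mulrDl.
  by rewrite addrA addNr add0r.
- move=> a; apply: cderZ; apply: cderM; last exact: cder_expi.
  by apply: (@has_pd_slice _ _ j f (pderive j f)) => x; exact: tsmooth_pd.
- apply: ccontM; first exact: ccont_cst.
  apply: ccontD; first by apply: slice_expi_ccont; exact: tsmooth_pderive.
  apply: ccontM; first exact: slice_ccont.
  by apply: ccontM; [exact: ccont_cst|exact: ccont_expi].
- move=> a; rewrite /dG normcM normc_expi mul1r.
  apply: le_trans (normcD _ _) _; rewrite !normcM normc_expi !mulr1.
  by apply: lerD => //; rewrite ler_wpM2r// normc_ge0.
- move=> a; rewrite /G periodic_upd; last exact: fs.1.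
  by rewrite (mulrDl a) expi_2pi_int.
Qed.

Definition tproj j (N : nat) f z : R[i] :=
  \sum_(i < N.*2.+1) eproj j (freq N i) f z.

Lemma tproj_rate j N f (B1 B2 : R) z : tsmooth f ->
  (forall x, normc (pderive j f x) <= B1) ->
  (forall x, normc (pderive j (pderive j f) x) <= B2) ->
  normc (f z - tproj j N f z) <= 48 * (B1 + B2) / N.+1%:R.
Proof.
move=> fs f1B f2B.
have f1s := tsmooth_pderive j fs.
rewrite /tproj; under eq_bigr do rewrite eproj_shift//.
have sh (h : R -> R[i]) (x : R) (l : R[i]) : cder h (z 0 j + x) l -> cder (fun t => h (z 0 j + t)) x l.
  have D (u : R -> R) (m : R) : is_derive (z 0 j + x) 1 u m ->
      is_derive x 1 (fun t => u (z 0 j + t)) m.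
    move=> H; have H2 : is_derive x 1 (fun t : R => z 0 j + t) (1 : R).
      rewrite (_ : (fun t => z 0 j + t) = shift (z 0 j)); first exact: is_derive_shift.
      by apply/funext => t; rewrite /shift /= addrC.
    by have := @is_derive1_comp R u _ x _ _ H H2; rewrite mulr1.
  by move=> [h1 h2]; split; exact: D.
have cs : ccont (fun a => f (upd z j (z 0 j + a))).
  apply: (@cder_ccont _ _ (fun a => pderive j f (upd z j (z 0 j + a)))) => t.
  apply: (sh (fun a : R => f (upd z j a))).
  by apply: (@has_pd_slice _ _ j f (pderive j f)) => x; exact: tsmooth_pd.
have := @fourier_rate R (fun a => f (upd z j (z 0 j + a)))
  (fun a => pderive j f (upd z j (z 0 j + a)))
  (fun a => pderive j (pderive j f) (upd z j (z 0 j + a))) B1 B2 N.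
rewrite !addr0 !upd_id -mulr_sumr -cint_sum; last first.
  by move=> i; apply: ccontM => //; exact: ccont_expi.
under [in X in _ -> X]eq_fun do rewrite -mulr_sumr.
apply.
- move=> x; apply: (sh (fun a : R => f (upd z j a))).
  by apply: (@has_pd_slice _ _ j f (pderive j f)) => y; exact: tsmooth_pd.
- move=> x; apply: (sh (fun a : R => pderive j f (upd z j a))).
  by apply: (@has_pd_slice _ _ j _ (pderive j (pderive j f))) => y; exact: tsmooth_pd.
- by move=> x; exact: f1B.
- by move=> x; exact: f2B.
- by rewrite periodic_upd ?upd_id//; exact: fs.1.
- by rewrite periodic_upd ?upd_id//; exact: f1s.1.
Qed.

End Projection.

(** * Symmetry of derivatives and balls of ultradifferentiable functions *)

Lemma le0_of_rate (R : realType) (x K : R) :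
  (forall N : nat, x <= K / N.+1%:R) -> x <= 0.
Proof.
move=> H; rewrite leNgt; apply/negP => x0.
have K0 : 0 <= K / x.
  have := H 0%N; rewrite divr1 => xK; rewrite divr_ge0 ?(ltW x0)//.
  exact: le_trans (ltW x0) xK.
have := archi_boundP K0; set n := Num.bound _ => Kn.
have := H n; rewrite ler_pdivlMr// leNgt => /negP; apply.
move: Kn; rewrite ltr_pdivrMr// => /lt_le_trans; apply.
by rewrite mulrC ler_wpM2l ?(ltW x0)// ler_nat.
Qed.

Section Words.
Variables (R : realType) (d : nat).
Implicit Types (f g : 'rV[R]_d -> R[i]) (x y z : 'rV[R]_d) (j k : 'I_d).

Lemma lin_subE (f g : 'rV[R]_d -> R[i]) :
  (fun x => f x - g x) = (fun x => 1 * f x + (- 1) * g x).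
Proof. by apply/funext => x; rewrite mul1r mulN1r. Qed.

Lemma lin_scaleE (a : R[i]) (f : 'rV[R]_d -> R[i]) :
  (fun x => a * f x) = (fun x => a * f x + 0 * f x).
Proof. by apply/funext => x; rewrite mul0r addr0. Qed.

Lemma tsmoothZ (a : R[i]) f : tsmooth f -> tsmooth (fun x => a * f x).
Proof. by move=> fs; rewrite lin_scaleE; exact: tsmooth_lin. Qed.

Lemma tsmoothB f g : tsmooth f -> tsmooth g -> tsmooth (fun x => f x - g x).
Proof. by move=> fs gs; rewrite lin_subE; exact: tsmooth_lin. Qed.

Lemma pderiveZ j (a : R[i]) f x : tsmooth f ->
  pderive j (fun x => a * f x) x = a * pderive j f x.
Proof. by move=> fs; rewrite lin_scaleE pderive_lin// mul0r addr0. Qed.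

Lemma eprojZ j n (a : R[i]) f x : tsmooth f ->
  eproj j n (fun x => a * f x) x = a * eproj j n f x.
Proof. by move=> fs; rewrite lin_scaleE eproj_lin// mul0r addr0. Qed.

Lemma eprojB j n f g x : tsmooth f -> tsmooth g ->
  eproj j n (fun x => f x - g x) x = eproj j n f x - eproj j n g x.
Proof. by move=> fs gs; rewrite lin_subE eproj_lin// mul1r mulN1r. Qed.

Lemma pderive_eproj_same j n f : tsmooth f ->
  pderive j (eproj j n f) = fun x => (0 -i* n%:~R) * eproj j n f x.
Proof. by move=> fs; rewrite pderive_eproj//; apply/funext => x; exact: eproj_by_parts. Qed.

(** Symmetry of second derivatives by Fourier series: on a component in the
    variable j the derivative in j is a scalar, so it commutes with the one in
    k.  Hence all components of the difference of the two mixed derivatives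
    vanish, and so does this difference, which is the limit of its partial
    sums. *)
Lemma pderiveC j k f : tsmooth f ->
  pderive j (pderive k f) = pderive k (pderive j f).
Proof.
move=> fs; have sj := tsmooth_pderive j fs; have sk := tsmooth_pderive k fs.
have sjk := tsmooth_pderive j sk; have skj := tsmooth_pderive k sj.
pose h := fun x => pderive j (pderive k f) x - pderive k (pderive j f) x.
have hs : tsmooth h by exact: tsmoothB.
have h0 n z : eproj j n h z = 0.
  apply: etrans (eprojB j n z sjk skj) _.
  apply/eqP; rewrite subr_eq0; apply/eqP.
  apply: etrans (eproj_by_parts j n z sk) _.
  have E : eproj j n (pderive j f) = fun x => (0 -i* n%:~R) * eproj j n f x.
    by apply/funext => x; exact: eproj_by_parts.
  have := pderive_eproj j n k sj; rewrite E => /(congr1 (fun u => u z))  E2; apply: (etrans _ E2); symmetry.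
  rewrite (pderiveZ k _ z (tsmooth_eproj j n fs)).
  by rewrite (pderive_eproj j n k fs).
have [B1 B10 hB1] := tsmooth_bounded (tsmooth_pderive j hs).
have [B2 B20 hB2] := tsmooth_bounded (tsmooth_pderive j (tsmooth_pderive j hs)).
apply/funext => z; apply/eqP; rewrite -subr_eq0; apply/eqP.
apply: normc_eq0; apply/le_anti; rewrite normc_ge0 andbT.
apply: (@le0_of_rate _ _ (48 * (B1 + B2))) => N.
have := tproj_rate N z hs hB1 hB2.
by rewrite /tproj big1 ?subr0// => i _; exact: h0.
Qed.

Lemma tsmooth_Dj j f : tsmooth f -> tsmooth (Dj j f).
Proof. by move=> fs; apply: tsmoothZ; exact: tsmooth_pderive. Qed.

Lemma Dj_lin j (a b : R[i]) f g : tsmooth f -> tsmooth g ->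
  Dj j (fun x => a * f x + b * g x) = fun x => a * Dj j f x + b * Dj j g x.
Proof. by move=> fs gs; apply/funext => x; rewrite /Dj (pderive_lin j a b x fs gs); ring. Qed.

Lemma DjC j k f : tsmooth f -> Dj j (Dj k f) = Dj k (Dj j f).
Proof.
move=> fs; apply/funext => x; rewrite /Dj.
have sj := tsmooth_pderive j fs; have sk := tsmooth_pderive k fs.
rewrite (pderiveZ j _ x sk) (pderiveZ k _ x sj).
by rewrite (congr1 (fun u => u x) (pderiveC j k fs)).
Qed.

Lemma Dj_eproj j n k f : tsmooth f -> Dj k (eproj j n f) = eproj j n (Dj k f).
Proof.
move=> fs; apply/funext => x; rewrite /Dj (pderive_eproj j n k fs).
by rewrite (eprojZ j n _ x (tsmooth_pderive k fs)).
Qed.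

Lemma Dj_eproj_same j n f : tsmooth f ->
  Dj j (eproj j n f) = fun x => (- n%:~R)%:C * eproj j n f x.
Proof.
move=> fs; apply/funext => x; rewrite /Dj (pderive_eproj_same j n fs) mulrA; congr (_ * _).
by apply: complex_ext; rewrite ?cReM ?cImM /=; ring.
Qed.

(** Derivatives are indexed by words in the variables instead of multi-indices,
    because the letters of a word can be consumed one by one in any order. *)
Definition wder (w : seq 'I_d) f := foldr (@Dj R d) f w.

Lemma wder_cons j w f : wder (j :: w) f = Dj j (wder w f).
Proof. by []. Qed.

Lemma wder_cat w1 w2 f : wder (w1 ++ w2) f = wder w1 (wder w2 f).
Proof. by rewrite /wder foldr_cat. Qed.

Lemma tsmooth_wder w f : tsmooth f -> tsmooth (wder w f).
Proof. move=> fs; elim: w => [|j w IH]; [exact: fs|exact: (tsmooth_Dj j IH)]. Qed.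

Lemma wder_lin w (a b : R[i]) f g : tsmooth f -> tsmooth g ->
  wder w (fun x => a * f x + b * g x) = fun x => a * wder w f x + b * wder w g x.
Proof.
move=> fs gs; elim: w => [//|j w IH]; rewrite wder_cons IH.
exact: (Dj_lin j a b (tsmooth_wder w fs) (tsmooth_wder w gs)).
Qed.

Lemma wderB w f g : tsmooth f -> tsmooth g ->
  wder w (fun x => f x - g x) = fun x => wder w f x - wder w g x.
Proof. by move=> fs gs; rewrite lin_subE wder_lin// -lin_subE. Qed.

Lemma wder_eproj w j n f : tsmooth f -> wder w (eproj j n f) = eproj j n (wder w f).
Proof.
move=> fs; elim: w => [//|k w IH]; rewrite wder_cons IH.
exact: (Dj_eproj j n k (tsmooth_wder w fs)).
Qed.

Lemma wder_rot j w1 w2 f : tsmooth f ->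
  wder (w1 ++ j :: w2) f = wder (j :: w1 ++ w2) f.
Proof.
move=> fs; elim: w1 => [//|k w1 IH].
rewrite cat_cons wder_cons IH wder_cons.
exact: (DjC k j (tsmooth_wder (w1 ++ w2) fs)).
Qed.

Lemma wder_perm w w' f : tsmooth f -> perm_eq w w' -> wder w f = wder w' f.
Proof.
move=> fs; elim: w w' => [|j w IH] w' ww'.
  by have /perm_size := ww'; case: w' {ww'}.
have jw' : j \in w' by rewrite -(perm_mem ww') mem_head.
case/splitPr: jw' ww' => w1 w2; rewrite perm_sym -cat1s perm_catCA /= perm_cons.
move=> H; rewrite (wder_rot j w1 w2 fs) !wder_cons.
by rewrite (IH (w1 ++ w2))// perm_sym.
Qed.

(** The word of the multi-index alpha, in the order in which Dalpha
    differentiates. *)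
Definition word_of (alpha : 'I_d -> nat) : seq 'I_d :=
  flatten [seq nseq (alpha j) j | j <- enum 'I_d].

Lemma Dalpha_wder alpha f : Dalpha alpha f = wder (word_of alpha) f.
Proof.
rewrite /Dalpha /word_of; elim: (enum 'I_d) => //= j l IH.
rewrite wder_cat IH; elim: (alpha j) => [//|n IHn].
by rewrite iterS IHn.
Qed.

Lemma size_word_of alpha : size (word_of alpha) = mdeg alpha.
Proof.
rewrite /word_of size_flatten /shape -map_comp sumnE big_map big_enum /mdeg.
by apply: eq_bigr => j _; rewrite /= size_nseq.
Qed.

Lemma perm_word_of w : perm_eq w (word_of (fun j => count_mem j w)).
Proof.
apply/allP => k _ /=; rewrite /word_of count_flatten -map_comp sumnE big_map big_enum /=.
rewrite (bigD1 k)//= count_nseq /= eqxx mul1n big1 ?addn0// => j jk.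
by rewrite count_nseq /= (negbTE jk).
Qed.

Lemma wder_Dalpha w f : tsmooth f ->
  wder w f = Dalpha (fun j => count_mem j w) f.
Proof. by move=> fs; rewrite Dalpha_wder; exact: wder_perm (perm_word_of w). Qed.

Lemma mdeg_count w : mdeg (fun j => count_mem j w) = size w.
Proof. by rewrite -size_word_of -(perm_size (perm_word_of w)). Qed.

End Words.

Section Balls.
Variables (R : realType) (m : nat -> R).
Hypothesis m_gt0 : forall n, 0 < m n.

Definition wt (h : R) (n : nat) : R := h ^+ n * m n * n`!%:R.

(** The ball of radius N of the Banach space of parameter h.  All words are
    constrained, whereas ultranorm only involves derivatives in one order of
    the variables; for smooth periodic functions this makes no difference, by
    the symmetry of second derivatives. *)
Definition udball (d : nat) (h N : R) (f : 'rV[R]_d -> R[i]) : Prop :=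
  tsmooth f /\ forall w x, normc (wder w f x) <= N * wt h (size w).

Lemma wt_gt0 h n : 0 < h -> 0 < wt h n.
Proof. by move=> h0; rewrite !mulr_gt0// ?exprn_gt0// ltr0n fact_gt0. Qed.

Lemma wt_le h h' n : 0 < h -> h <= h' -> wt h n <= wt h' n.
Proof.
move=> h0 hh'; rewrite /wt -!mulrA ler_wpM2r//.
  by rewrite mulr_ge0// ltW.
by rewrite lerXn2r// nnegrE ltW// (lt_le_trans h0).
Qed.

Variable d : nat.
Implicit Types (f g : 'rV[R]_d -> R[i]).

Lemma udball_ge0 h N f : 0 < h -> udball h N f -> 0 <= N.
Proof.
move=> h0 [_ /(_ [::] 0)] H; have := le_trans (normc_ge0 _) H.
by rewrite pmulr_lge0// wt_gt0.
Qed.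

Lemma udball_le h h' N N' f : 0 < h -> h <= h' -> N <= N' ->
  udball h N f -> udball h' N' f.
Proof.
move=> h0 hh' NN' fN; have N0 := udball_ge0 h0 fN.
case: fN => fs fN; split=> // w x; apply: le_trans (fN w x) _.
by apply: ler_pM => //; [exact/ltW/wt_gt0|exact: wt_le].
Qed.

Lemma udball_lin h N N' (a b : R[i]) f g : udball h N f -> udball h N' g ->
  udball h (normc a * N + normc b * N') (fun x => a * f x + b * g x).
Proof.
move=> [fs fN] [gs gN]; split; first exact: tsmooth_lin.
move=> w x; rewrite wder_lin//; apply: le_trans (normcD _ _) _.
rewrite mulrDl !normcM -!mulrA.
by apply: lerD; rewrite ler_wpM2l// normc_ge0.
Qed.

Lemma ultradiff_tsmooth f : ultradiff m f -> tsmooth f.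
Proof. by case. Qed.

Lemma udball_ultradiff h N f : 0 < h -> udball h N f -> ultradiff m f.
Proof.
move=> h0 fN; have N0 := udball_ge0 h0 fN; case: fN => -[fp fs] fN; split=> //.
exists (N + 1), h; split=> //; first exact: ltr_wpDl.
move=> x alpha; rewrite Dalpha_wder; apply: le_trans (fN _ _) _.
rewrite size_word_of -!mulrA [h ^+ _ * _]mulrA -/(wt h (mdeg alpha)).
by rewrite ler_wpM2r ?lerDl//; exact/ltW/wt_gt0.
Qed.

Lemma ultradiff_udball f : ultradiff m f ->
  exists h N : R, [/\ 0 < h, 0 < N & udball h N f].
Proof.
move=> [fp fs [N [h [N0 h0 fN]]]]; exists h, N; split=> //; split=> // w x.
rewrite wder_Dalpha//; apply: le_trans (fN _ _) _.
by rewrite mdeg_count /wt !mulrA.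
Qed.

Lemma udball_ultranorm h N f : 0 < h -> udball h N f -> (ultranorm m h f <= N%:E)%E.
Proof.
move=> h0 [_ fN]; apply: ge_ereal_sup => _ [[x alpha] _ <-] /=.
rewrite lee_fin ler_pdivrMr; last exact: wt_gt0.
by rewrite Dalpha_wder -size_word_of; exact: fN.
Qed.

Lemma ultradiffh_udball h f : 0 < h -> ultradiffh m h f ->
  exists N : R, ultranorm m h f = N%:E /\ udball h N f.
Proof.
move=> h0 [fp fs foo].
have H x alpha : ((normc (Dalpha alpha f x) / wt h (mdeg alpha))%:E <= ultranorm m h f)%E.
  by apply: ereal_sup_ubound; exists (x, alpha).
have foo' : ultranorm m h f \is a fin_num.
  rewrite fin_numE; apply/andP; split; last by rewrite lt_eqF.
  by rewrite gt_eqF// (lt_le_trans _ (H 0 (fun=> 0%N)))// ltNyr.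
exists (fine (ultranorm m h f)); rewrite fineK//; split=> //; split=> // w x.
have := H x (fun j => count_mem j w).
rewrite -(fineK foo') lee_fin -wder_Dalpha// mdeg_count.
by rewrite ler_pdivrMr//; exact: wt_gt0.
Qed.

Lemma udball_ultradiffh h N f : 0 < h -> udball h N f -> ultradiffh m h f.
Proof.
move=> h0 fN; case: (fN) => -[fp fs] _; split=> //.
by apply: le_lt_trans (udball_ultranorm h0 fN) _; exact: ltry.
Qed.

Lemma ultradiffh_ultradiff h f : 0 < h -> ultradiffh m h f -> ultradiff m f.
Proof.
by move=> h0 /(ultradiffh_udball h0)[N [_ fN]]; exact: udball_ultradiff fN.
Qed.

Lemma ultradiff_lin (a b : R[i]) f g : ultradiff m f -> ultradiff m g ->
  ultradiff m (fun x => a * f x + b * g x).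
Proof.
move=> /ultradiff_udball[h [N [h0 N0 fN]]] /ultradiff_udball[h' [N' [h'0 N'0 gN]]].
have hm : 0 < Num.max h h' by rewrite lt_max h0.
apply: (@udball_ultradiff (Num.max h h')) => //.
apply: udball_lin; first by apply: udball_le fN => //; rewrite le_max lexx.
by apply: udball_le gN => //; rewrite le_max lexx orbT.
Qed.

End Balls.

(** * Weight sequences and bounded functionals *)

Section Weights.
Variables (R : realType) (m : nat -> R).
Hypothesis hm : weight_sequence m.

Lemma weight_gt0 n : 0 < m n.
Proof. by case: hm. Qed.

Let r n := m n.+1 / m n.

Lemma weight_ratioS n : r n <= r n.+1.
Proof.
case: hm => _ _ lc _; rewrite /r ler_pdivrMr ?weight_gt0// mulrAC.
rewrite ler_pdivlMr ?weight_gt0// -expr2.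
by have := lc n.+1 isT; rewrite mulrC.
Qed.

Lemma weight_ratio_le p q : (p <= q)%N -> r p <= r q.
Proof.
move=> /subnK <-; elim: (q - p)%N => [|k IH]; first by rewrite add0n.
by apply: le_trans IH _; rewrite addSn; exact: weight_ratioS.
Qed.

Lemma weightS n : m n.+1 = r n * m n.
Proof. by rewrite /r divfK// gt_eqF// weight_gt0. Qed.

Lemma weight_ge1 n : 1 <= m n.
Proof.
case: hm => _ [m0 m1] _ _; elim: n => [|n IH]; first by rewrite m0.
rewrite weightS -[leLHS]mulr1; apply: ler_pM => //.
by apply: le_trans (weight_ratio_le (leq0n n)); rewrite /r m0 m1 divr1.
Qed.

Lemma weight_mul_le p q : m p * m q <= m (p + q)%N.
Proof.
case: hm => _ [m0 m1] _ _; elim: p => [|p IH]; first by rewrite m0 mul1r.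
rewrite addSn !weightS -mulrA; apply: ler_pM => //.
- by rewrite divr_ge0// ltW// weight_gt0.
- by rewrite mulr_ge0// ltW// weight_gt0.
- exact: weight_ratio_le (leq_addr _ _).
Qed.

(** For q = 1 this is the stability condition m_(n+1) <= H^(n+1) m_n together
    with n + 1 <= 2^n. *)
Lemma wt_shift h q : 0 < h -> exists h' C : R,
  [/\ 0 < h', 0 < C & forall n, wt m h (n + q) <= C * wt m h' n].
Proof.
move=> h0; have [_ [_ m1] _ [H H1 HM]] := hm; have H0 : 0 < H by apply: lt_trans H1.
elim: q => [|q [h' [C [h'0 C0 IH]]]].
  by exists h, 1; split=> // n; rewrite addn0 mul1r.
exists (2 * (h' * H)), (C * (h' * H)).
split; [by rewrite !mulr_gt0|by rewrite !mulr_gt0|].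
move=> n; rewrite addnS -addSn; apply: le_trans (IH _) _.
rewrite -mulrA ler_wpM2l ?(ltW C0)// /wt.
have M1 : m n.+1 <= H ^+ n.+1 * m n by have := HM n 1%N; rewrite addn1 m1 mulr1.
have F : n.+1`!%:R <= 2 ^+ n * n`!%:R :> R.
  by rewrite factS natrM ler_wpM2r// -natrX ler_nat; exact: ltn_expl.
have E : h' * H * ((2 * (h' * H)) ^+ n * m n * n`!%:R) =
    h' ^+ n.+1 * (H ^+ n.+1 * m n) * (2 ^+ n * n`!%:R).
  by rewrite !exprMn !exprS; ring.
rewrite E; apply: ler_pM => //.
  by rewrite mulr_ge0 ?exprn_ge0 ?ltW// weight_gt0.
by rewrite ler_wpM2l// exprn_ge0// ltW.
Qed.

(** As m p >= 1, the left-hand side is at most a term of the exponential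
    series. *)
Lemma exp_weight_bounded (a : R) : 0 <= a ->
  forall p, a ^+ p / (m p * p`!%:R) <= 1 + expR a.
Proof.
move=> a0 p.
have f0 : 0 < p`!%:R :> R by rewrite ltr0n fact_gt0.
apply: (@le_trans _ _ (a ^+ p / p`!%:R)).
  rewrite ler_wpM2l ?exprn_ge0// lef_pV2 ?posrE ?mulr_gt0 ?weight_gt0//.
  by apply: ler_peMl; [exact: ltW|exact: weight_ge1].
case: p {f0} => [|p]; first by rewrite fact0 divr1 lerDl expR_ge0.
have := expR_ge1Dxn p a0; have := expR_ge0 a; lra.
Qed.

End Weights.

Section Functionals.
Variables (R : realType) (m : nat -> R) (h_ : nat -> R).
Hypothesis m_gt0 : forall n, 0 < m n.
Hypothesis hh : exhausting h_.

Lemma exhausting_gt0 n : 0 < h_ n.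
Proof. by case: hh. Qed.

Lemma exhausting_ge (h : R) : exists n, h <= h_ n.
Proof.
case: hh => _ _ /cvgryPge/(_ h)[n _ Hn]; exists n; exact: (Hn n (leqnn n)).
Qed.

Variable d : nat.
Implicit Types (u : functional R d) (f g : 'rV[R]_d -> R[i]).

Definition ultralinear u := forall (a b : R[i]) f g,
  ultradiff m f -> ultradiff m g ->
  u (fun x => a * f x + b * g x) = a * u f + b * u g.

Definition ultrabounded u := forall h : R, 0 < h ->
  exists2 K : R, 0 < K & forall N f, udball m h N f -> normc (u f) <= K * N.

Lemma tsmooth0 : tsmooth (fun _ : 'rV[R]_d => 0 : R[i]).
Proof.
pose C h := h = (fun _ : 'rV[R]_d => 0 : R[i]).
apply: (@tsmooth_class _ _ C) => [_ ->|_ ->|_ -> j|].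
- by move=> x k.
- exact: ccont_cst.
- by exists (fun _ => 0) => // x; exact: cder_cst.
- by [].
Qed.

Lemma udball0 h : udball m h 0 (fun _ : 'rV[R]_d => 0 : R[i]).
Proof.
split; first exact: tsmooth0.
move=> w x; rewrite mul0r.
have E0 : (fun _ : 'rV[R]_d => 0 : R[i]) = (fun _ => 0 * 0 + 0 * 0).
  by apply/funext => y; rewrite mul0r addr0.
have E1 := wder_lin w 0 0 tsmooth0 tsmooth0.
have -> : wder w (fun _ : 'rV[R]_d => 0 : R[i]) x = 0.
  apply: (etrans (congr1 (fun u : 'rV[R]_d -> R[i] => wder w u x) E0)).
  apply: (etrans (congr1 (fun u : 'rV[R]_d -> R[i] => u x) E1)).
  by rewrite !mul0r addr0.
by rewrite normc0.
Qed.

Lemma ultralinearZ u (a : R[i]) f : ultralinear u -> ultradiff m f ->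
  u (fun x => a * f x) = a * u f.
Proof. by move=> ul fU; rewrite lin_scaleE ul// mul0r addr0. Qed.

Lemma ultralinearB u f g : ultralinear u -> ultradiff m f -> ultradiff m g ->
  u (fun x => f x - g x) = u f - u g.
Proof. by move=> ul fU gU; rewrite lin_subE ul// mul1r mulN1r. Qed.

(** Rescale f into a neighbourhood of 0 on which u has modulus less than 1. *)
Lemma ultradist_bounded u : ultradist m h_ u -> ultrabounded u.
Proof.
move=> [ul uc] h h0.
have U0 : ultradiff m (fun _ : 'rV[R]_d => 0 : R[i]).
  exact: (udball_ultradiff m_gt0 ltr01 (udball0 1)).
have u0 : u (fun=> 0) = 0.
  have -> : (fun _ : 'rV[R]_d => 0 : R[i]) = (fun x => 0 * (fun _ => 0) x).
    by apply/funext => x; rewrite mul0r.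
  by rewrite ultralinearZ// mul0r.
have [W [V [VU Vac Vn VW]] Wc] := uc _ _ U0 ltr01.
have [n hn] := exhausting_ge h.
have [r r0 Vr] := Vn n.
exists (2 / r); first by rewrite divr_gt0.
move=> N f fN; have N0 := udball_ge0 m_gt0 h0 fN.
have fU := udball_ultradiff m_gt0 h0 fN.
apply/ler_addgt0Pr => e e0.
(* N' is positive even when N = 0, and 2 N' / r exceeds 2 N / r by exactly e *)
pose N' := N + e * r / 2.
have N'0 : 0 < N' by rewrite ltr_wpDl// !mulr_gt0// invr_gt0.
pose c := r / (2 * N').
have c0 : 0 < c by rewrite divr_gt0// mulr_gt0.
have H : normc (u (fun x => c%:C * f x)) < 1.
  rewrite -[u _]subr0 -u0; apply: Wc.
    by rewrite lin_scaleE; exact: ultradiff_lin.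
  apply: VW.
  have -> : (fun x => c%:C * f x - 0) = (fun x => c%:C * f x + 0 * f x).
    by apply/funext => x; rewrite subr0 mul0r addr0.
  have fN' : udball m h N' f.
    by apply: udball_le fN => //; rewrite lerDl !mulr_ge0 ?ltW// invr_gt0.
  have B := udball_lin (c%:C) 0 fN' fN'.
  rewrite normc0 mul0r addr0 normc_real (gtr0_norm c0) in B.
  have B' := udball_le m_gt0 h0 hn (lexx _) B.
  have hn0 := exhausting_gt0 n.
  apply: Vr; first exact: (udball_ultradiffh m_gt0 hn0 B').
  apply: le_lt_trans (udball_ultranorm m_gt0 hn0 B') _.
  rewrite lte_fin /c; have -> : r / (2 * N') * N' = r / 2 by field; rewrite gt_eqF.
  by rewrite ltr_pdivrMr// ltr_pMr// ltr1n.
move: H; rewrite ultralinearZ// normcM normc_real (gtr0_norm c0) mulrC.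
rewrite -ltr_pdivlMr// /c => /ltW/le_trans; apply.
rewrite le_eqVlt; apply/orP; left; apply/eqP.
have -> : 2 / r * N + e = 2 * N' / r by rewrite /N'; field; rewrite gt_eqF.
by field; rewrite !gt_eqF.
Qed.

(** The set where u has modulus less than e is absolutely convex, and it is a
    neighbourhood of 0 in every Banach space of the family. *)
Lemma bounded_ultradist u : ultralinear u -> ultrabounded u -> ultradist m h_ u.
Proof.
move=> ul ub; split=> // f e fU e0.
pose V := [set g | ultradiff m g /\ normc (u g) < e].
exists V; last first.
  move=> g gU [_]; rewrite ultralinearB//.
exists V; split=> //.
- by move=> g [].
- move=> a b g1 g2 [U1 n1] [U2 n2] ab; split; first exact: ultradiff_lin.
  rewrite ul//; apply: le_lt_trans (normcD _ _) _; rewrite !normcM.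
  have M0 : 0 <= Num.max (normc (u g1)) (normc (u g2)).
    by rewrite le_max normc_ge0.
  apply: (@le_lt_trans _ _ (Num.max (normc (u g1)) (normc (u g2)))); last first.
    by rewrite gt_max n1.
  apply: (@le_trans _ _ ((normc a + normc b) * Num.max (normc (u g1)) (normc (u g2)))).
    by rewrite mulrDl; apply: lerD; rewrite ler_wpM2l ?normc_ge0// le_max lexx ?orbT.
  by rewrite ler_piMl.
- move=> n; have hn0 := exhausting_gt0 n; have [K K0 HK] := ub _ hn0.
  exists (e / K); first by rewrite divr_gt0.
  move=> g gU gr; split; first exact: (ultradiffh_ultradiff m_gt0 hn0 gU).
  have [N [gN gB]] := ultradiffh_udball m_gt0 hn0 gU.
  apply: le_lt_trans (HK _ _ gB) _.
  by move: gr; rewrite gN lte_fin ltr_pdivlMr// mulrC.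
Qed.

Lemma ultradist_linear u : ultradist m h_ u -> ultralinear u.
Proof. by case. Qed.

End Functionals.

Lemma ultrabounded_comp (R : realType) (m : nat -> R) (d d' : nat)
    (u : functional R d) (T : ('rV[R]_d' -> R[i]) -> ('rV[R]_d -> R[i])) :
  (forall h : R, 0 < h -> exists h' C : R, [/\ 0 < h', 0 < C &
     forall N f, udball m h N f -> udball m h' (C * N) (T f)]) ->
  ultrabounded m u -> ultrabounded m (fun f => u (T f)).
Proof.
move=> HT ub h h0; have [h' [C [h'0 C0 TC]]] := HT h h0.
have [K K0 HK] := ub h' h'0; exists (K * C); first exact: mulr_gt0.
by move=> N f fN; rewrite -mulrA; apply: HK; exact: TC.
Qed.

Lemma ultrabounded_scale (R : realType) (m : nat -> R) (d : nat)
    (u : functional R d) (c : R[i]) :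
  (forall n, 0 < m n) -> ultrabounded m u -> ultrabounded m (fun f => c * u f).
Proof.
move=> m0 ub h h0; have [K K0 HK] := ub h h0.
exists ((normc c + 1) * K); first by rewrite mulr_gt0// ltr_wpDl// normc_ge0.
move=> N f fN; have N0 := udball_ge0 m0 h0 fN.
rewrite normcM -mulrA; apply: ler_pM; rewrite ?normc_ge0//; last exact: HK.
by rewrite lerDl.
Qed.

(** * Products of a function of t and a character of x *)

Section Tensor.
Variables (R : realType) (r s : nat) (eta : 'rV[int]_s).
Implicit Types (psi : 'rV[R]_r -> R[i]) (z : 'rV[R]_(r + s)).

Definition tens psi z : R[i] := psi (lsubmx z) * expi (- dotZ (rsubmx z) eta).

Lemma lsubmx_updl z j t : lsubmx (upd z (lshift s j) t) = upd (lsubmx z) j t.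
Proof. by apply/rowP => k; rewrite !mxE eq_lshift. Qed.

Lemma rsubmx_updl z j t : rsubmx (upd z (lshift s j) t) = rsubmx z.
Proof. by apply/rowP => k; rewrite !mxE eq_rlshift. Qed.

Lemma lsubmx_updr z j t : lsubmx (upd z (rshift r j) t) = lsubmx z.
Proof. by apply/rowP => k; rewrite !mxE eq_lrshift. Qed.

Lemma rsubmx_updr z j t : rsubmx (upd z (rshift r j) t) = upd (rsubmx z) j t.
Proof. by apply/rowP => k; rewrite !mxE eq_rshift. Qed.

Lemma dotZ_upd (x : 'rV[R]_s) k t :
  dotZ (upd x k t) eta = dotZ (upd x k 0) eta + t * (eta 0 k)%:~R.
Proof.
rewrite /dotZ (bigD1 k)//= [in RHS](bigD1 k)//= !updE eqxx mul0r add0r addrC.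
by congr (_ + _); apply: eq_bigr => i ik; rewrite !updE (negbTE ik).
Qed.

Lemma normc_tens psi z : normc (tens psi z) = normc (psi (lsubmx z)).
Proof. by rewrite normcM normc_expi mulr1. Qed.

Lemma tens_lin psi psi' (a b : R[i]) z :
  tens (fun t => a * psi t + b * psi' t) z = a * tens psi z + b * tens psi' z.
Proof. by rewrite /tens; ring. Qed.

Lemma tensZ psi (a : R[i]) z : tens (fun t => a * psi t) z = a * tens psi z.
Proof. by rewrite /tens mulrA. Qed.

Lemma has_pd_tensl psi j z : tsmooth psi ->
  has_pd (lshift s j) (tens psi) z (tens (pderive j psi) z).
Proof.
move=> ps; rewrite /has_pd /tens.
have E : (fun t => psi (lsubmx (upd z (lshift s j) t)) *
    expi (- dotZ (rsubmx (upd z (lshift s j) t)) eta)) =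
  (fun t => psi (upd (lsubmx z) j t) * expi (- dotZ (rsubmx z) eta)).
  by apply/funext => t; rewrite lsubmx_updl rsubmx_updl.
rewrite E; have H := tsmooth_pd j (lsubmx z) ps.
have zE : z 0 (lshift s j) = lsubmx z 0 j by rewrite mxE.
by rewrite zE; apply: cder_eq (cderM H (cder_cst _ _)) _; rewrite mulr0 addr0.
Qed.

Lemma has_pd_tensr psi k z :
  has_pd (rshift r k) (tens psi) z ((0 -i* (eta 0 k)%:~R) * tens psi z).
Proof.
rewrite /has_pd /tens.
have E : (fun t => psi (lsubmx (upd z (rshift r k) t)) *
    expi (- dotZ (rsubmx (upd z (rshift r k) t)) eta)) =
  (fun t => (psi (lsubmx z) * expi (- dotZ (upd (rsubmx z) k 0) eta)) *
     expi (t * - (eta 0 k)%:~R)).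
  apply/funext => t; rewrite lsubmx_updr rsubmx_updr dotZ_upd opprD expiD mulrN.
  by rewrite mulrA.
rewrite E; apply: cder_eq (cderZ _ (cder_expi (- (eta 0 k)%:~R) (z 0 (rshift r k)))) _.
have zE : z 0 (rshift r k) = rsubmx z 0 k by rewrite mxE.
have -> : dotZ (rsubmx z) eta = dotZ (upd (rsubmx z) k 0) eta + z 0 (rshift r k) * (eta 0 k)%:~R.
  by rewrite -dotZ_upd zE upd_id.
by rewrite opprD expiD mulrN; ring.
Qed.

Lemma tens_periodic psi : torus_periodic psi -> torus_periodic (tens psi).
Proof.
move=> pp z k; rewrite /tens; congr (_ * _).
  rewrite -[RHS](pp _ (lsubmx k)); congr psi.
  by apply/rowP => i; rewrite !mxE.
have -> : dotZ (rsubmx (z + 2 * pi *: map_mx intr k)) eta =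
   dotZ (rsubmx z) eta + 2 * pi * (\sum_(j < s) rsubmx k 0 j * eta 0 j)%:~R.
  rewrite /dotZ rmorph_sum mulr_sumr -big_split; apply: eq_bigr => j _ /=.
  by rewrite !mxE intrM; ring.
by rewrite opprD -mulrN -intrN expi_2pi_int.
Qed.

Lemma tsmooth_tens psi : tsmooth psi -> tsmooth (tens psi).
Proof.
move=> ps; pose C h := exists2 u, tsmooth u & h = tens u.
apply: (@tsmooth_class _ _ C) => [_ [u us ->]|_ [u us ->]|_ [u us ->] k|].
- by apply: tens_periodic; exact: us.1.
- have [B0 B00 HB0] := tsmooth_bounded us.
  have [B1 B10 HB1] := tsmooth_pderive_bounded us.
  pose g (k : 'I_(r + s)) : 'rV[R]_(r + s) -> R[i] :=
    match fintype.split k with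
    | inl j => tens (pderive j u)
    | inr j => fun z => (0 -i* (eta 0 j)%:~R) * tens u z
    end.
  pose B : R := B1 + (\sum_(j < s) `|(eta 0 j)%:~R|) * B0.
  have S0 : 0 <= \sum_(j < s) `|(eta 0 j)%:~R : R| by apply: sumr_ge0 => j _.
  apply: (@lipschitz_ccont _ _ _ (2 * B * (r + s)%:R)).
  apply: (@lipschitz_of_pd _ _ _ g); last by rewrite addr_ge0// mulr_ge0.
    move=> k z; rewrite -(splitK k) /g unsplitK.
    by case: (fintype.split k) => j /=; [exact: has_pd_tensl|exact: has_pd_tensr].
  move=> k z; rewrite /g; case: (fintype.split k) => j.
    by rewrite normc_tens (le_trans (HB1 _ _))// lerDl mulr_ge0.
  rewrite normcM normc_tens (le_trans _ (_ : (\sum_(j < s) `|(eta 0 j)%:~R|) * B0 <= _))//.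
    apply: ler_pM; rewrite ?normc_ge0//.
    rewrite /= expr0n /= add0r sqrrN sqrtr_sqr (bigD1 j)//= lerDl.
    by apply: sumr_ge0.
  by rewrite lerDr.
- rewrite -(splitK k); case: (fintype.split k) => j /=.
    exists (tens (pderive j u)).
      exact: (ex_intro2 _ _ (pderive j u) (tsmooth_pderive j us) erefl).
    by move=> z; exact: has_pd_tensl.
  exists (fun z => (0 -i* (eta 0 j)%:~R) * tens u z); last by move=> z; exact: has_pd_tensr.
  exists (fun t => (0 -i* (eta 0 j)%:~R) * u t); first exact: tsmoothZ.
  by apply/funext => z; rewrite tensZ.
- by exists psi.
Qed.

Lemma Dj_tensl psi j : tsmooth psi -> Dj (lshift s j) (tens psi) = tens (Dj j psi).
Proof.
move=> ps; apply/funext => z.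
have /has_pdP[_ E] := has_pd_tensl j z ps.
by rewrite /Dj E tensZ.
Qed.

Lemma Dj_tensr psi k :
  Dj (rshift r k) (tens psi) = fun z => (- (eta 0 k)%:~R)%:C * tens psi z.
Proof.
apply/funext => z; have /has_pdP[_ E] := has_pd_tensr psi k z.
rewrite /Dj E mulrA; congr (_ * _).
by apply: complex_ext; rewrite ?cReM ?cImM /=; ring.
Qed.

Lemma eta_le_eucl k : `|(eta 0 k)%:~R| <= eucl R eta.
Proof.
rewrite /eucl -sqrtr_sqr ler_sqrt; last by apply: sumr_ge0 => j _; exact: sqr_ge0.
by rewrite (bigD1 k)//= lerDl; apply: sumr_ge0 => j _; exact: sqr_ge0.
Qed.

Lemma eucl_ge0 : 0 <= eucl R eta.
Proof. exact: sqrtr_ge0. Qed.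

Lemma Dj_scale (d : nat) (k : 'I_d) (c : R[i]) (f : 'rV[R]_d -> R[i]) : tsmooth f ->
  Dj k (fun x => c * f x) = fun x => c * Dj k f x.
Proof.
move=> fs; apply/funext => x; rewrite /Dj (pderiveZ k c x fs); ring.
Qed.

(** A derivative in t falls on psi, and a derivative in x multiplies by minus a
    coordinate of eta. *)
Lemma wder_tens psi w : tsmooth psi -> exists w' (c : R[i]) q,
  [/\ size w = (size w' + q)%N, normc c <= eucl R eta ^+ q &
     wder w (tens psi) = fun z => c * tens (wder w' psi) z].
Proof.
move=> ps; elim: w => [|k w [w' [c [q [sw cq E]]]]].
  exists [::], 1, 0%N; rewrite expr0; split=> //.
    by rewrite ComplexField.Normc.normc1.
  by apply/funext => z; rewrite mul1r.
have w's := tsmooth_wder w' ps.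
have ts := tsmooth_tens w's.
rewrite wder_cons E (Dj_scale k c ts) -(splitK k); case: (fintype.split k) => j /=.
  exists (j :: w'), c, q; split=> //; first by rewrite sw.
  by rewrite (Dj_tensl j w's).
exists w', (c * (- (eta 0 j)%:~R)%:C), q.+1; split=> //; first by rewrite sw addnS.
  rewrite normcM normc_real normrN exprSr; apply: ler_pM => //; first exact: normc_ge0.
  exact: eta_le_eucl.
by rewrite Dj_tensr; apply/funext => z; rewrite mulrA.
Qed.

Variable m : nat -> R.
Hypothesis hm : weight_sequence m.

(** The bound G turns the factor |eta|^q of q derivatives in x into
    eps^-q m_q q!; the powers of h and eps^-1 are absorbed in the new parameter,
    and m_p m_q <= m_(p+q), p! q! <= (p+q)!. *)
Lemma udball_tens (h eps N G : R) psi : 0 < h -> 0 < eps ->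
  (forall p, eps ^+ p * (1 + eucl R eta) ^+ p / (m p * p`!%:R) <= G) ->
  udball m h N psi -> udball m (Num.max h eps^-1) (N * G) (tens psi).
Proof.
move=> h0 e0 HG pN; have m0 := weight_gt0 hm.
have N0 := udball_ge0 m0 h0 pN; case: pN => ps pN.
split; first exact: tsmooth_tens.
move=> w z; have [w' [c [q [-> cq ->]]]] := wder_tens w ps.
rewrite normcM normc_tens.
set h' := Num.max h eps^-1; set p := size w'.
have h'0 : 0 < h' by rewrite lt_max h0.
have q0 : 0 < m q * q`!%:R by rewrite mulr_gt0// ltr0n fact_gt0.
have c1 : normc c <= G * (eps^-1 ^+ q * (m q * q`!%:R)).
  apply: le_trans cq _.
  apply: (@le_trans _ _ ((1 + eucl R eta) ^+ q)).
    by rewrite lerXn2r ?nnegrE ?addr_ge0 ?eucl_ge0// lerDr.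
  have := HG q; rewrite ler_pdivrMr// => H.
  rewrite mulrCA exprVn -ler_pdivrMl ?invr_gt0 ?exprn_gt0// invrK.
  exact: H.
have G0 : 0 <= G.
  by apply: le_trans (HG 0%N); rewrite !expr0 mulr1 divr_ge0// mulr_ge0// ltW.
have -> : N * G * wt m h' (p + q) = G * (N * wt m h' (p + q)) by ring.
apply: (@le_trans _ _ (G * (eps^-1 ^+ q * (m q * q`!%:R)) * (N * wt m h p))).
  by apply: ler_pM; rewrite ?normc_ge0//; exact: pN.
have -> : G * (eps^-1 ^+ q * (m q * q`!%:R)) * (N * wt m h p) =
  G * (N * (h ^+ p * eps^-1 ^+ q * (m p * m q) * (p`!%:R * q`!%:R))).
  by rewrite /wt; ring.
rewrite ler_wpM2l// ler_wpM2l// /wt.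
apply: ler_pM; last 1 first.
- by rewrite -natrM ler_nat -(bin_fact (leq_addl p q)) addnK mulnC leq_pmull// bin_gt0 leq_addl.
- by rewrite !mulr_ge0// ?exprn_ge0// ?invr_ge0 ltW.
- by rewrite mulr_ge0.
apply: ler_pM; last exact: weight_mul_le.
- by rewrite mulr_ge0 ?exprn_ge0 ?invr_ge0// ltW.
- by rewrite mulr_ge0// ltW.
rewrite exprD; apply: ler_pM; rewrite ?exprn_ge0 ?invr_ge0 ?(ltW h0) ?(ltW e0)//.
  by rewrite lerXn2r ?nnegrE ?(ltW h0) ?(ltW h'0)// le_max lexx.
by rewrite lerXn2r ?nnegrE ?invr_ge0 ?(ltW e0) ?(ltW h'0)// le_max lexx orbT.
Qed.

End Tensor.

(** * Fourier components in several variables *)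

Section IteratedProjection.
Variables (R : realType) (d : nat).
Implicit Types (f g : 'rV[R]_d -> R[i]) (z : 'rV[R]_d).

(** Components are taken in the variables iota 0, ..., iota (s - 1), at the
    frequency - eta. *)
Definition eprojs (s : nat) (iota : 'I_s -> 'I_d) (eta : 'rV[int]_s) f :=
  foldr (fun j g => eproj (iota j) (eta 0 j) g) f (enum 'I_s).

(** Written as a fold so that it unfolds along the recursion defining
    torus_int. *)
Definition place (s : nat) (iota : 'I_s -> 'I_d) z (x : 'rV[R]_s) : 'rV[R]_d :=
  foldl (fun acc j => upd acc (iota j) (x 0 j)) z (enum 'I_s).

Lemma tsmooth_eprojs s (iota : 'I_s -> 'I_d) eta f :
  tsmooth f -> tsmooth (eprojs iota eta f).
Proof.
move=> fs; rewrite /eprojs; elim: (enum 'I_s) => [//|j l IH].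
exact: (tsmooth_eproj _ _ IH).
Qed.

Lemma eprojs_rec s (iota : 'I_s.+1 -> 'I_d) (eta : 'rV[int]_s.+1) f :
  eprojs iota eta f = eproj (iota ord0) (eta 0 ord0)
    (eprojs (fun j => iota (lift ord0 j)) (\row_j eta 0 (lift ord0 j)) f).
Proof.
rewrite /eprojs enum_ordSl /= foldr_map; congr (eproj _ _ _).
by elim: (enum 'I_s) => [//|j l /= ->]; rewrite mxE.
Qed.

Lemma row_mx_ord0 (T : Type) s (a : T) (y : 'rV[T]_s) :
  row_mx (const_mx a : 'rV_1) y 0 ord0 = a.
Proof.
have E : ord0 = lshift s ord0 :> 'I_(1 + s) by apply: val_inj.
by rewrite E row_mxEl mxE.
Qed.

Lemma row_mx_lift (T : Type) s (a : T) (y : 'rV[T]_s) j :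
  row_mx (const_mx a : 'rV_1) y 0 (lift ord0 j) = y 0 j.
Proof.
have E : lift ord0 j = rshift 1 j :> 'I_(1 + s) by apply: val_inj.
by rewrite E row_mxEr.
Qed.

Lemma place_rec s (iota : 'I_s.+1 -> 'I_d) z (a : R) (y : 'rV[R]_s) :
  place iota z (row_mx (const_mx a : 'rV_1) y) =
  place (fun j => iota (lift ord0 j)) (upd z (iota ord0) a) y.
Proof.
rewrite /place enum_ordSl /=.
rewrite row_mx_ord0.
elim: (enum 'I_s) (upd _ _ _) => [//|j l IH] z' /=.
by rewrite IH row_mx_lift.
Qed.

Lemma dotZ_rec s (eta : 'rV[int]_s.+1) (a : R) (y : 'rV[R]_s) :
  dotZ (row_mx (const_mx a : 'rV_1) y) eta =
  a * (eta 0 ord0)%:~R + dotZ y (\row_j eta 0 (lift ord0 j)).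
Proof.
rewrite /dotZ big_ord_recl; congr (_ * _ + _).
  exact: row_mx_ord0.
apply: eq_bigr => j _; rewrite [in RHS]mxE; congr (_ * _).
exact: row_mx_lift.
Qed.

Lemma torus_int_rec s (F : 'rV[R]_s.+1 -> R[i]) :
  torus_int F = cint (fun a => torus_int (fun y : 'rV[R]_s => F (row_mx (const_mx a : 'rV_1) y))).
Proof. by []. Qed.

(** Induction on s.  The constant c lets the character of the outermost variable
    enter the inner iterated integral before the induction hypothesis is
    applied. *)
Lemma torus_int_eprojs s (iota : 'I_s -> 'I_d) (eta : 'rV[int]_s) f (c : R[i]) z :
  injective iota -> tsmooth f ->
  torus_int (fun x => c * (f (place iota z x) * expi (dotZ x eta))) =
  c * ((2 * pi) ^+ s)%:C * expi (\sum_(j < s) z 0 (iota j) * (eta 0 j)%:~R) *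
    eprojs iota eta f z.
Proof.
elim: s iota eta c z => [|s IH] iota eta c z inj fs.
  rewrite big_ord0 expi0 expr0 !mulr1 /torus_int /=.
  have -> : place iota z 0 = z by rewrite /place enum_ord0.
  have -> : dotZ 0 eta = 0 :> R by rewrite /dotZ big_ord0.
  have -> : eprojs iota eta f = f by rewrite /eprojs enum_ord0.
  by rewrite expi0 mulr1; case: (c * f z).
rewrite torus_int_rec eprojs_rec.
set iota' := fun j => iota (lift ord0 j).
set eta' := \row_j eta 0 (lift ord0 j).
have inj' : injective iota'.
  by move=> i j /inj /lift_inj.
have E a : torus_int (fun y : 'rV[R]_s => c * (f (place iota z (row_mx (const_mx a : 'rV_1) y))
       * expi (dotZ (row_mx (const_mx a : 'rV_1) y) eta))) =
  (c * ((2 * pi) ^+ s)%:C * expi (\sum_(j < s) z 0 (iota' j) * (eta' 0 j)%:~R)) *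
  (eprojs iota' eta' f (upd z (iota ord0) a) * expi (a * (eta 0 ord0)%:~R)).
  have -> : (fun y : 'rV[R]_s => c * (f (place iota z (row_mx (const_mx a : 'rV_1) y))
       * expi (dotZ (row_mx (const_mx a : 'rV_1) y) eta))) =
    (fun y => (c * expi (a * (eta 0 ord0)%:~R)) *
      (f (place iota' (upd z (iota ord0) a) y) * expi (dotZ y eta'))).
    apply/funext => y; rewrite place_rec dotZ_rec expiD.
    by rewrite -/iota' -/eta'; ring.
  rewrite (IH iota' eta' _ _ inj' fs).
  have -> : \sum_(j < s) upd z (iota ord0) a 0 (iota' j) * (eta' 0 j)%:~R =
     \sum_(j < s) z 0 (iota' j) * (eta' 0 j)%:~R.
    apply: eq_bigr => j _; rewrite updE; case: eqP => // /inj H.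
    by have := neq_lift ord0 j; rewrite H eqxx.
  by ring.
under [X in cint X]eq_fun => a do rewrite E.
have gs := tsmooth_eprojs iota' eta' fs.
rewrite (cintZ _ (slice_expi_ccont (iota ord0) z (eta 0 ord0)%:~R gs)).
rewrite big_ord_recl expiD /eproj.
have -> : \sum_(i < s) z 0 (iota (lift ord0 i)) * (eta 0 (lift ord0 i))%:~R =
   \sum_(j < s) z 0 (iota' j) * (eta' 0 j)%:~R.
  by apply: eq_bigr => j _; rewrite mxE.
set I := cint _.
set P := 2 * pi; have P0 : P%:C != 0 :> R[i].
  by rewrite -(rmorph0 (real_complex R)) (inj_eq (@complexI R)) gt_eqF// twopi_gt0.
have PV : (P^-1)%:C = (P%:C)^-1 :> R[i] by rewrite fmorphV.
have PS : (P ^+ s.+1)%:C = P%:C * (P ^+ s)%:C :> R[i] by rewrite exprS rmorphM.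
rewrite PV PS.
have eN := expiN (z 0 (iota ord0) * (eta 0 ord0)%:~R).
set u := expi (- _) in eN *; set v := expi (z 0 (iota ord0) * _) in eN *.
set w := expi _.
have -> : c * (P%:C * (P ^+ s)%:C) * (v * w) * (P%:C^-1 * (I * u)) =
  (c * (P ^+ s)%:C * w * I) * (u * v) * (P%:C * P%:C^-1) by ring.
by rewrite eN divff// !mulr1.
Qed.

Lemma place_out s (iota : 'I_s -> 'I_d) z (x : 'rV[R]_s) k :
  (forall j, iota j != k) -> place iota z x 0 k = z 0 k.
Proof.
move=> Hk; rewrite /place; elim: (enum 'I_s) z => [//|j l IH] z /=.
by rewrite IH updE eq_sym (negbTE (Hk j)).
Qed.

Lemma place_in s (iota : 'I_s -> 'I_d) z (x : 'rV[R]_s) j :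
  injective iota -> place iota z x 0 (iota j) = x 0 j.
Proof.
move=> inj; rewrite /place.
have := mem_enum 'I_s j; rewrite inE.
elim: (enum 'I_s) z => [//|i l IH] z /=; rewrite in_cons.
have [jl _|jl] := boolP (j \in l); first exact: IH.
rewrite orbF => /eqP <-.
elim: l {IH} jl (upd z _ _) (updE z (iota j) (x 0 j) (iota j)) => [|i' l IH].
  by move=> _ z' ->; rewrite eqxx.
rewrite in_cons negb_or => /andP[ji jl] z' E /=; apply: IH => //.
by rewrite updE (inj_eq inj) (negbTE ji).
Qed.

Variable m : nat -> R.
Hypothesis hm : weight_sequence m.

Lemma wder_eprojs s (iota : 'I_s -> 'I_d) eta f w :
  tsmooth f -> wder w (eprojs iota eta f) = eprojs iota eta (wder w f).
Proof.
move=> fs.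
suff H l : tsmooth (foldr (fun j g => eproj (iota j) (eta 0 j) g) f l) /\
  wder w (foldr (fun j g => eproj (iota j) (eta 0 j) g) f l) =
  foldr (fun j g => eproj (iota j) (eta 0 j) g) (wder w f) l.
  exact: (H (enum 'I_s)).2.
elim: l => [//|j l [IH1 IH2]] /=; split; first exact: (tsmooth_eproj _ _ IH1).
by rewrite (wder_eproj w _ _ IH1) IH2.
Qed.

Lemma eprojs_lin s (iota : 'I_s -> 'I_d) eta (a b : R[i]) f g :
  tsmooth f -> tsmooth g ->
  eprojs iota eta (fun x => a * f x + b * g x) =
  fun x => a * eprojs iota eta f x + b * eprojs iota eta g x.
Proof.
move=> fs gs; pose F l h := foldr (fun j g => eproj (iota j) (eta 0 j) g) h l.
have Fs l h : tsmooth h -> tsmooth (F l h).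
  by move=> hs; elim: l => [//|j l IH]; exact: (tsmooth_eproj _ _ IH).
suff H l : F l (fun x => a * f x + b * g x) = fun x => a * F l f x + b * F l g x.
  exact: H.
elim: l => [//|j l IH]; apply/funext => x.
rewrite [LHS]/(eproj _ _ (F l (fun x => a * f x + b * g x)) x) IH.
exact: (eproj_lin (iota j) (eta 0 j) a b x (Fs l f fs) (Fs l g gs)).
Qed.

Lemma eprojs_bound s (iota : 'I_s -> 'I_d) eta f (B : R) z :
  tsmooth f -> (forall x, normc (f x) <= B) ->
  normc (eprojs iota eta f z) <= 2 ^+ s * B.
Proof.
move=> fs fB; pose F l := foldr (fun j g => eproj (iota j) (eta 0 j) g) f l.
have Fs l : tsmooth (F l).
  by elim: l => [//|j l IH]; exact: (tsmooth_eproj _ _ IH).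
suff H l x : normc (F l x) <= 2 ^+ size l * B.
  by have := H (enum 'I_s) z; rewrite size_enum_ord.
elim: l x => [|j l IH] x; first by rewrite expr0 mul1r; exact: fB.
by rewrite [size _]/= exprS -mulrA; exact: (eproj_bound (iota j) (eta 0 j) x (Fs l) IH).
Qed.

Lemma udball_eprojs s (iota : 'I_s -> 'I_d) eta h N f :
  udball m h N f -> udball m h (2 ^+ s * N) (eprojs iota eta f).
Proof.
move=> [fs fN]; split; first exact: tsmooth_eprojs.
move=> w x; rewrite (wder_eprojs iota eta w fs) -mulrA.
exact: (eprojs_bound iota eta x (tsmooth_wder w fs) (fN w)).
Qed.

Lemma Dj_eprojs s (iota : 'I_s -> 'I_d) eta f k : tsmooth f ->
  Dj (iota k) (eprojs iota eta f) =
  fun x => (- (eta 0 k)%:~R)%:C * eprojs iota eta f x.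
Proof.
move=> fs; pose F l := foldr (fun j g => eproj (iota j) (eta 0 j) g) f l.
have Fs l : tsmooth (F l).
  by elim: l => [//|j l IH]; exact: (tsmooth_eproj _ _ IH).
suff H l : k \in l -> Dj (iota k) (F l) = fun x => (- (eta 0 k)%:~R)%:C * F l x.
  by apply: H; rewrite mem_enum.
elim: l => [//|j l IH]; rewrite in_cons.
have [-> _|kj /=] := eqVneq k j.
  exact: (Dj_eproj_same (iota j) (eta 0 j) (Fs l)).
move=> /IH E; apply/funext => x.
apply: (etrans (congr1 (fun u : 'rV[R]_d -> R[i] => u x)
  (Dj_eproj (iota j) (eta 0 j) (iota k) (Fs l)))).
rewrite E; exact: (eprojZ (iota j) (eta 0 j) _ x (Fs l)).
Qed.

Lemma wder_scale (w : seq 'I_d) (c : R[i]) f : tsmooth f ->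
  wder w (fun x => c * f x) = fun x => c * wder w f x.
Proof.
move=> fs; elim: w => [//|j w IH]; rewrite !wder_cons IH.
exact: (Dj_scale j c (tsmooth_wder w fs)).
Qed.

Lemma wder_nseq_eprojs s (iota : 'I_s -> 'I_d) eta f k p : tsmooth f ->
  wder (nseq p (iota k)) (eprojs iota eta f) =
  fun x => (- (eta 0 k)%:~R)%:C ^+ p * eprojs iota eta f x.
Proof.
move=> fs; elim: p => [|p IH].
  by apply/funext => x; rewrite expr0 mul1r.
have gs := tsmooth_eprojs iota eta fs.
rewrite [nseq _ _]/= wder_cons IH (Dj_scale _ _ gs) (Dj_eprojs iota eta k fs).
by apply/funext => x; rewrite exprSr mulrA.
Qed.

(** On a component, p derivatives in the variable iota k multiply by
    (- eta_k)^p, while they cost only an enlargement of h. *)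
Lemma udball_eprojs_decay s (iota : 'I_s -> 'I_d) (h : R) (p : nat) : 0 < h ->
  exists h' C : R, [/\ 0 < h', 0 < C & forall N f (eta : 'rV[int]_s) k, udball m h N f ->
    udball m h' (C * N / `|(eta 0 k)%:~R| ^+ p) (eprojs iota eta f) \/ eta 0 k = 0].
Proof.
move=> h0; have [h' [C [h'0 C0 HC]]] := wt_shift hm p h0.
exists h', (2 ^+ s * C); split=> //; first by rewrite mulr_gt0// exprn_gt0.
move=> N f eta k fN; have N0 := udball_ge0 (weight_gt0 hm) h0 fN.
have [->|k0] := eqVneq (eta 0 k) 0; [by right|left].
have a0 : 0 < `|(eta 0 k)%:~R : R| ^+ p by rewrite exprn_gt0// normr_gt0 intr_eq0.
case: fN => fs fN; split; first exact: tsmooth_eprojs.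
have gs := tsmooth_eprojs iota eta fs.
move=> w x; rewrite mulrAC ler_pdivlMr//.
have -> : normc (wder w (eprojs iota eta f) x) * `|(eta 0 k)%:~R| ^+ p =
   normc (wder (w ++ nseq p (iota k)) (eprojs iota eta f) x).
  rewrite wder_cat (wder_nseq_eprojs iota eta k p fs) (wder_scale w _ gs).
  by rewrite normcM normcX normc_real normrN mulrC.
rewrite (wder_eprojs iota eta _ fs).
have := eprojs_bound iota eta x (tsmooth_wder (w ++ nseq p (iota k)) fs)
   (fN (w ++ nseq p (iota k))).
move=> /le_trans; apply; rewrite size_cat size_nseq -!mulrA ler_wpM2l ?exprn_ge0//.
by rewrite mulrCA ler_wpM2l.
Qed.

End IteratedProjection.

(** * Truncation to a cube of frequencies *)

Section FiniteSums.
Variables (R : realType) (d : nat).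
Implicit Types (f g : 'rV[R]_d -> R[i]) (z : 'rV[R]_d).

Lemma sum_consE (I : Type) (i : I) (r : seq I) (F : I -> 'rV[R]_d -> R[i]) :
  (fun z => \sum_(k <- i :: r) F k z) =
  (fun z => 1 * F i z + 1 * (\sum_(k <- r) F k z)).
Proof. by apply/funext => z; rewrite big_cons !mul1r. Qed.

Lemma sum_nilE (I : Type) (F : I -> 'rV[R]_d -> R[i]) :
  (fun z => \sum_(k <- [::]) F k z) = fun=> 0.
Proof. by apply/funext => z; rewrite big_nil. Qed.

Lemma tsmooth_sum (I : Type) (r : seq I) (F : I -> 'rV[R]_d -> R[i]) :
  (forall i, tsmooth (F i)) -> tsmooth (fun z => \sum_(i <- r) F i z).
Proof.
move=> Fs; elim: r => [|i r IH]; first by rewrite sum_nilE; exact: tsmooth0.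
by rewrite sum_consE; exact: (tsmooth_lin 1 1 (Fs i) IH).
Qed.

Lemma wder0 w : wder w (fun _ : 'rV[R]_d => 0) = fun=> 0.
Proof.
apply/funext => x; have [_ /(_ w x)] := @udball0 R (fun=> 1) d 1.
by rewrite mul0r => H; apply: normc_eq0; apply/le_anti; rewrite H normc_ge0.
Qed.

Lemma wder_sum (I : Type) (r : seq I) (F : I -> 'rV[R]_d -> R[i]) w :
  (forall i, tsmooth (F i)) ->
  wder w (fun z => \sum_(i <- r) F i z) = fun z => \sum_(i <- r) wder w (F i) z.
Proof.
move=> Fs; elim: r => [|i r IH]; first by rewrite !sum_nilE wder0.
rewrite [in RHS]sum_consE [in LHS]sum_consE.
by rewrite (wder_lin w 1 1 (Fs i) (tsmooth_sum r Fs)) IH.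
Qed.

Lemma eproj_sum (I : Type) (r : seq I) (F : I -> 'rV[R]_d -> R[i]) j n z :
  (forall i, tsmooth (F i)) ->
  eproj j n (fun z => \sum_(i <- r) F i z) z = \sum_(i <- r) eproj j n (F i) z.
Proof.
move=> Fs; elim: r => [|i r IH].
  rewrite sum_nilE big_nil.
  have E : (fun _ : 'rV[R]_d => 0 : R[i]) = (fun x => 0 * (fun _ => 0) x).
    by apply/funext => x; rewrite mul0r.
  apply: (etrans (congr1 (fun u : 'rV[R]_d -> R[i] => eproj j n u z) E)).
  exact: (etrans (eprojZ j n 0 z (tsmooth0 R d)) (mul0r _)).
rewrite sum_consE big_cons.
by rewrite (eproj_lin j n 1 1 z (Fs i) (tsmooth_sum r Fs)) IH !mul1r.
Qed.

Lemma ultradiff_sum (m : nat -> R) (I : Type) (r : seq I) (F : I -> 'rV[R]_d -> R[i]) :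
  (forall n, 0 < m n) -> (forall i, ultradiff m (F i)) ->
  ultradiff m (fun z => \sum_(i <- r) F i z).
Proof.
move=> m0 FU; elim: r => [|i r IH].
  by rewrite sum_nilE; exact: (udball_ultradiff m0 ltr01 (udball0 m d 1)).
by rewrite sum_consE; exact: (ultradiff_lin m0 1 1 (FU i) IH).
Qed.

Lemma ultralinear_sum (m : nat -> R) (u : functional R d) (I : Type) (r : seq I)
    (F : I -> 'rV[R]_d -> R[i]) :
  (forall n, 0 < m n) -> ultralinear m u -> (forall i, ultradiff m (F i)) ->
  u (fun z => \sum_(i <- r) F i z) = \sum_(i <- r) u (F i).
Proof.
move=> m0 ul FU; elim: r => [|i r IH].
  have U0 := udball_ultradiff m0 ltr01 (udball0 m d 1).
  rewrite sum_nilE big_nil.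
  have E : (fun _ : 'rV[R]_d => 0 : R[i]) = (fun x => 0 * (fun _ => 0) x).
    by apply/funext => x; rewrite mul0r.
  exact: (etrans (congr1 u E) (etrans (ultralinearZ 0 ul U0) (mul0r _))).
by rewrite sum_consE big_cons ul ?IH ?mul1r//; exact: ultradiff_sum.
Qed.

Definition freqs (K : nat) : seq int := [seq freq K i | i <- iota 0 K.*2.+1].

Lemma tprojE j K f z : tproj j K f z = \sum_(n <- freqs K) eproj j n f z.
Proof.
rewrite /tproj /freqs big_map -(big_mkord xpredT (fun i => eproj j (freq K i) f z)).
by rewrite /index_iota subn0.
Qed.

Lemma tproj_sumE j K f : tproj j K f = fun z => \sum_(n <- freqs K) eproj j n f z.
Proof. by apply/funext => z; exact: tprojE. Qed.

Lemma tsmooth_tproj j K f : tsmooth f -> tsmooth (tproj j K f).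
Proof.
by move=> fs; rewrite tproj_sumE; apply: tsmooth_sum => n; exact: (tsmooth_eproj j n fs).
Qed.

Lemma wder_tproj j K f w : tsmooth f -> wder w (tproj j K f) = tproj j K (wder w f).
Proof.
move=> fs; rewrite !tproj_sumE wder_sum => [|n]; last exact: (tsmooth_eproj j n fs).
apply/funext => z; apply: eq_bigr => n _.
by rewrite (wder_eproj w j n fs).
Qed.

Lemma tprojB j K f g z : tsmooth f -> tsmooth g ->
  tproj j K (fun x => f x - g x) z = tproj j K f z - tproj j K g z.
Proof.
move=> fs gs; rewrite !tprojE -sumrB; apply: eq_bigr => n _.
exact: (eprojB j n z fs gs).
Qed.

Lemma normc_Dj j f x : normc (Dj j f x) = normc (pderive j f x).
Proof. by rewrite /Dj normcM /= expr0n /= add0r sqrrN expr1n sqrtr1 mul1r. Qed.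

Lemma normc_Dj2 j f x : tsmooth f ->
  normc (Dj j (Dj j f) x) = normc (pderive j (pderive j f) x).
Proof.
move=> fs; rewrite normc_Dj /Dj (pderiveZ j _ x (tsmooth_pderive j fs)).
by rewrite normcM /= expr0n /= add0r sqrrN expr1n sqrtr1 mul1r.
Qed.

Variable m : nat -> R.
Hypothesis hm : weight_sequence m.

Lemma udball_tproj_rate j (h : R) : 0 < h -> exists h' C : R,
  [/\ 0 < h', 0 < C & forall N f K, udball m h N f ->
    udball m h' (C * N / K.+1%:R) (fun z => f z - tproj j K f z)].
Proof.
move=> h0; have m0 := weight_gt0 hm.
have [h1 [C1 [h10 C10 HC1]]] := wt_shift hm 1 h0.
have [h2 [C2 [h20 C20 HC2]]] := wt_shift hm 2 h0.
set h' := Num.max h1 h2.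
have h'0 : 0 < h' by rewrite lt_max h10.
exists h', (48 * (C1 + C2)); split=> //; first by rewrite mulr_gt0// addr_gt0.
move=> N f K fN; have N0 := udball_ge0 m0 h0 fN; case: fN => fs fN.
split; first exact: (tsmoothB fs (tsmooth_tproj j K fs)).
move=> w x; rewrite (wderB w fs (tsmooth_tproj j K fs)) (wder_tproj j K w fs).
have gs := tsmooth_wder w fs.
have := @tproj_rate R d j K (wder w f) (N * wt m h (size w + 1)) (N * wt m h (size w + 2)) x gs.
move=> H; apply: le_trans (H _ _) _.
- by move=> y; rewrite -normc_Dj addn1; exact: (fN (j :: w)).
- by move=> y; rewrite -(normc_Dj2 j y gs) addn2; exact: (fN [:: j, j & w]).
have -> : 48 * (C1 + C2) * N / K.+1%:R * wt m h' (size w) =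
  48 * (N * (C1 * wt m h' (size w)) + N * (C2 * wt m h' (size w))) / K.+1%:R by ring.
rewrite ler_wpM2r// ler_wpM2l//.
apply: lerD; rewrite ler_wpM2l//.
  apply: le_trans (HC1 _) _; rewrite ler_wpM2l ?(ltW C10)//.
  by apply: wt_le => //; rewrite le_max lexx.
apply: le_trans (HC2 _) _; rewrite ler_wpM2l ?(ltW C20)//.
by apply: wt_le => //; rewrite le_max lexx orbT.
Qed.

(** Let g be the truncation of f in all variables but the first, and T the
    truncation in the first one.  Then f - T g = (f - T f) + T (f - g), where
    T D = D - (D - T D) is controlled by D itself, uniformly in K. *)
Lemma tprojs_rate (l : seq 'I_d) (h : R) : 0 < h -> exists h' C : R,
  [/\ 0 < h', 0 < C & forall N f K, udball m h N f ->
    tsmooth (foldr (fun j g => tproj j K g) f l) /\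
    udball m h' (C * N / K.+1%:R)
      (fun z => f z - foldr (fun j g => tproj j K g) f l z)].
Proof.
have m0 := weight_gt0 hm.
move=> h0; elim: l => [|j l [h1 [C1 [h10 C10 IH]]]].
  exists h, 1; split=> // N f K fN; have N0 := udball_ge0 m0 h0 fN.
  split; first exact: fN.1.
  have -> : (fun z => f z - foldr (fun j g => tproj j K g) f [::] z) = fun=> 0.
    by apply/funext => z; rewrite subrr.
  apply: (udball_le m0 h0 (lexx h) _ (udball0 m d h)).
  by rewrite mul1r divr_ge0.
have [h2 [C2 [h20 C20 H2]]] := udball_tproj_rate j h10.
have [h3 [C3 [h30 C30 H3]]] := udball_tproj_rate j h0.
set h' := Num.max h1 (Num.max h2 h3).
have h'0 : 0 < h' by rewrite lt_max h10.
exists h', (C3 + (C1 + C2 * C1)).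
split=> //; first by rewrite !addr_gt0// mulr_gt0.
move=> N f K fN; have N0 := udball_ge0 m0 h0 fN; have fs := fN.1.
have [gs dN] := IH N f K fN.
set g := foldr _ f l in gs dN *.
have ds := dN.1.
split; first exact: (tsmooth_tproj j K gs).
set F := fun z => f z - tproj j K f z.
set D := fun z => f z - g z in dN ds *.
set E := fun z => D z - tproj j K D z.
have -> : (fun z => f z - foldr (fun j g => tproj j K g) f (j :: l) z) =
  fun z => 1 * F z + 1 * (1 * D z + (- 1) * E z).
  apply/funext => z; rewrite /E /D (tprojB j K z fs gs) /F [foldr _ _ _]/= -/g.
  by ring.
have BF := H3 N f K fN; have BE := H2 _ _ K dN.
have K1 : 1 <= K.+1%:R :> R by rewrite ler1n.
have BE' : udball m h2 (C2 * C1 * N / K.+1%:R) E.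
  apply: (udball_le m0 h20 (lexx _) _ BE).
  rewrite !mulrA ler_pdivrMr// ler_peMr// divr_ge0// !mulr_ge0// ltW//.
have h1h' : h1 <= h' by rewrite le_max lexx.
have h2h' : h2 <= h' by rewrite !le_max lexx orbT.
have h3h' : h3 <= h' by rewrite !le_max lexx !orbT.
have B1 := udball_lin 1 (- 1) (udball_le m0 h10 h1h' (lexx _) dN)
  (udball_le m0 h20 h2h' (lexx _) BE').
have B2 := udball_lin 1 1 (udball_le m0 h30 h3h' (lexx _) BF) B1.
apply: (udball_le m0 h'0 (lexx _) _ B2).
rewrite normcN ComplexField.Normc.normc1 !mul1r.
by rewrite le_eqVlt; apply/orP; left; apply/eqP; ring.
Qed.

End FiniteSums.

Section Boxes.
Variable R : realType.

Lemma mem_freqs K (n : int) : (n \in freqs K) = (`|n| <= K%:Z).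
Proof.
apply/mapP/idP => [[q]|nK].
  by rewrite mem_iota add0n /= => iK ->; rewrite /freq; move: iK; rewrite -addnn; lia.
exists (absz (n + K%:Z)); last by rewrite /freq; lia.
by rewrite mem_iota add0n /= -addnn; lia.
Qed.

Lemma uniq_freqs K : uniq (freqs K).
Proof.
rewrite map_inj_uniq ?iota_uniq// => i j /eqP.
by rewrite /freq (inj_eq (addIr _)) eqz_nat => /eqP.
Qed.

Fixpoint box (s K : nat) : seq 'rV[int]_s :=
  match s return seq 'rV[int]_s with
  | 0%N => [:: 0]
  | s'.+1 => [seq row_mx (const_mx n : 'rV_1) eta | n <- freqs K, eta <- box s' K]
  end.

Lemma boxS s K : box s.+1 K =
  [seq (row_mx (const_mx n : 'rV_1) eta : 'rV[int]_s.+1) | n <- freqs K, eta <- box s K].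
Proof. by []. Qed.

Lemma size_box s K : size (box s K) = (K.*2.+1 ^ s)%N.
Proof.
elim: s => [//|s IH].
have F : size (freqs K) = K.*2.+1 by rewrite size_map size_iota.
by rewrite expnS -IH -[X in (X * _)%N]F; exact: size_allpairs.
Qed.

Lemma row_mx_recl s (eta : 'rV[int]_s.+1) :
  eta = row_mx (const_mx (eta 0 ord0) : 'rV_1) (\row_j eta 0 (lift ord0 j)).
Proof.
apply/rowP => j; case: (unliftP ord0 j) => [k ->|->].
  by rewrite row_mx_lift mxE.
by rewrite row_mx_ord0.
Qed.

Lemma uniq_box s K : uniq (box s K).
Proof.
elim: s => [//|s IH].
apply: (@allpairs_uniq _ _ _ (fun n (eta : 'rV[int]_s) => row_mx (const_mx n : 'rV_1) eta)
  _ _ (uniq_freqs K) IH).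
move=> [n eta] [n' eta'] _ _ /= E; congr (_, _).
  by rewrite -(row_mx_ord0 n eta) E row_mx_ord0.
by apply/rowP => j; rewrite -(row_mx_lift n eta j) E row_mx_lift.
Qed.

Lemma mem_box s K (eta : 'rV[int]_s) :
  (forall j, `|eta 0 j| <= K%:Z) -> eta \in box s K.
Proof.
elim: s eta => [|s IH] eta H; first by rewrite inE; apply/eqP/rowP; case.
rewrite (row_mx_recl eta).
apply: (@allpairs_f _ _ _ (fun n (eta : 'rV[int]_s) => row_mx (const_mx n : 'rV_1) eta)).
  by rewrite mem_freqs.
by apply: IH => j; rewrite mxE.
Qed.

Lemma tprojs_box d s (iota : 'I_s -> 'I_d) K (f : 'rV[R]_d -> R[i]) z : tsmooth f ->
  foldr (fun j g => tproj j K g) f (map iota (enum 'I_s)) z =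
  \sum_(eta <- box s K) eprojs iota eta f z.
Proof.
elim: s iota z => [|s IH] iota z fs.
  by rewrite enum_ord0 /= big_seq1 /eprojs enum_ord0.
rewrite enum_ordSl map_cons -map_comp [foldr _ _ _]/=.
have -> : foldr (fun j g => tproj j K g) f (map (iota \o lift ord0) (enum 'I_s)) =
   fun z => \sum_(eta <- box s K) eprojs (iota \o lift ord0) eta f z.
  by apply/funext => y; exact: IH.
rewrite tprojE; rewrite boxS big_allpairs_dep.
apply: eq_bigr => n _.
rewrite (eproj_sum _ _ _ _ (fun eta => tsmooth_eprojs (iota \o lift ord0) eta fs)).
apply: eq_bigr => eta _; rewrite eprojs_rec row_mx_ord0.
have -> : \row_j (row_mx (const_mx n : 'rV_1) eta : 'rV[int]_s.+1) 0 (lift ord0 j) = eta.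
  by apply/rowP => j; rewrite mxE row_mx_lift.
by [].
Qed.

(** If all coordinates were smaller than k / s, the Euclidean norm would be at
    most k / sqrt s. *)
Lemma eucl_large s (eta : 'rV[int]_s) (k : nat) : (0 < s)%N ->
  k%:R < eucl R eta -> exists j, k%:R / s%:R <= `|(eta 0 j)%:~R : R|.
Proof.
move=> s0; apply: contraPP => /forallNP H; apply/negP; rewrite -leNgt.
have s1 : 1 <= s%:R :> R by rewrite ler1n.
have sp : 0 < s%:R :> R by rewrite ltr0n.
have k0 : 0 <= k%:R / s%:R :> R by rewrite divr_ge0.
rewrite /eucl -[leRHS]ger0_norm// -sqrtr_sqr ler_sqrt ?sqr_ge0//.
apply: (@le_trans _ _ (\sum_(j < s) (k%:R / s%:R) ^+ 2)).
  apply: ler_sum => j _; rewrite -(real_normK (num_real (eta 0 j)%:~R)).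
  rewrite lerXn2r// ?nnegrE//.
  by have /negP := H j; rewrite -ltNge => /ltW.
rewrite sumr_const card_ord -[leLHS]mulr_natl expr_div_n.
rewrite mulrCA ler_piMr ?sqr_ge0// expr2 invfM mulrA divff ?gt_eqF//.
by rewrite mul1r invf_le1.
Qed.

End Boxes.

(** * Fourier series of ultradistributions *)

Lemma leq_doubleS_3 k : (k.+1.*2.+1 <= 3 * k.+1)%N.
Proof. by rewrite -muln2; lia. Qed.

Section FourierSeries.
Variables (R : realType) (m : nat -> R).
Hypothesis hm : weight_sequence m.
Variables (r s : nat).
Variable u : functional R (r + s).
Hypothesis ul : ultralinear m u.
Hypothesis ub : ultrabounded m u.
Implicit Types (eta : 'rV[int]_s) (f phi : 'rV[R]_(r + s) -> R[i]).

Let m0 := weight_gt0 hm.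

Lemma ultradiff_tens eta (psi : 'rV[R]_r -> R[i]) :
  ultradiff m psi -> ultradiff m (tens eta psi).
Proof.
move=> /(ultradiff_udball)[h [N [h0 N0 pN]]].
have a0 : 0 <= 1 * (1 + eucl R eta) by rewrite mul1r addr_ge0// eucl_ge0.
have H := exp_weight_bounded hm a0.
have B : udball m (Num.max h 1^-1) (N * (1 + expR (1 * (1 + eucl R eta)))) (tens eta psi).
  by apply: udball_tens => // p; rewrite -exprMn; exact: H.
by apply: (udball_ultradiff m0 _ B); rewrite lt_max h0.
Qed.

Lemma partial_fourierE eta (psi : 'rV[R]_r -> R[i]) :
  partial_fourier u eta psi = ((2 * pi) ^- s)%:C * u (tens eta psi).
Proof. by []. Qed.

Lemma partial_fourier_linear eta : ultralinear m (partial_fourier u eta).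
Proof.
move=> a b f g fU gU; rewrite !partial_fourierE.
have -> : tens eta (fun x => a * f x + b * g x) =
    (fun z => a * tens eta f z + b * tens eta g z).
  by apply/funext => z; exact: tens_lin.
by rewrite (ul a b (ultradiff_tens eta fU) (ultradiff_tens eta gU)); ring.
Qed.

Lemma partial_fourier_bounded eta : ultrabounded m (partial_fourier u eta).
Proof.
apply: (ultrabounded_scale _ m0); apply: ultrabounded_comp ub => h h0.
exists (Num.max h 1^-1), (1 + expR (1 * (1 + eucl R eta))).
split; [by rewrite lt_max h0|by rewrite ltr_wpDr ?expR_ge0|].
move=> N f fN; rewrite mulrC.
have a0 : 0 <= 1 * (1 + eucl R eta) by rewrite mul1r addr_ge0// eucl_ge0.
have H := exp_weight_bounded hm a0.
by apply: udball_tens => // p; rewrite -exprMn; exact: H.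
Qed.

Lemma ultradiff_eprojs eta f :
  ultradiff m f -> ultradiff m (eprojs (@rshift r s) eta f).
Proof.
move=> /(ultradiff_udball)[h [N [h0 N0 fN]]].
exact: (udball_ultradiff m0 h0 (udball_eprojs (@rshift r s) eta fN)).
Qed.

Lemma place_rshift (z : 'rV[R]_(r + s)) (x : 'rV[R]_s) :
  place (@rshift r s) z x = row_mx (lsubmx z) x.
Proof.
apply/rowP => k; rewrite -(splitK k); case: (fintype.split k) => j /=.
  rewrite place_out; last by move=> i; rewrite eq_rlshift.
  by rewrite row_mxEl mxE.
by rewrite place_in ?row_mxEr//; exact: rshift_inj.
Qed.

(** The iterated integral against the characters, multiplied by the conjugate
    character, is (2 pi)^s times a component of phi. *)
Lemma mul_char_eprojs eta phi : ultradiff m phi ->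
  mul_char (partial_fourier u eta) eta phi = u (eprojs (@rshift r s) eta phi).
Proof.
move=> pU; have ps := ultradiff_tsmooth pU.
rewrite /mul_char partial_fourierE.
set P := ((2 * pi) ^+ s)%:C : R[i].
have P0 : P != 0.
  rewrite -(rmorph0 (real_complex R)) (inj_eq (@complexI R)).
  by rewrite expf_neq0// gt_eqF// twopi_gt0.
have -> : tens eta (fun t => torus_int (fun x => phi (row_mx t x) * expi (dotZ x eta))) =
   (fun z => P * eprojs (@rshift r s) eta phi z).
  apply/funext => z; rewrite /tens.
  have := torus_int_eprojs eta 1 z (@rshift_inj r s) ps.
  rewrite mul1r -/P.
  have -> : (fun x : 'rV[R]_s => 1 * (phi (place (@rshift r s) z x) * expi (dotZ x eta))) =
     (fun x => phi (row_mx (lsubmx z) x) * expi (dotZ x eta)).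
    by apply/funext => x; rewrite mul1r place_rshift.
  move=> ->.
  have -> : \sum_(j < s) z 0 (rshift r j) * (eta 0 j)%:~R = dotZ (rsubmx z) eta.
    by apply: eq_bigr => j _; rewrite mxE.
  set E := eprojs _ _ _ _.
  have -> : P * expi (dotZ (rsubmx z) eta) * E * expi (- dotZ (rsubmx z) eta) =
    P * E * (expi (- dotZ (rsubmx z) eta) * expi (dotZ (rsubmx z) eta)) by ring.
  by rewrite expiN mulr1.
rewrite (ultralinearZ _ ul (ultradiff_eprojs eta pU)) mulrA.
have -> : ((2 * pi) ^- s)%:C = P^-1 :> R[i] by rewrite fmorphV.
by rewrite mulVf// mul1r.
Qed.

Lemma partial_sumE (k : nat) phi : ultradiff m phi ->
  fourier_partial_sum u k phi =
  \sum_(eta <- box s k | eucl R eta <= k%:R) u (eprojs (@rshift r s) eta phi).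
Proof.
move=> pU; rewrite /fourier_partial_sum -[RHS]big_filter.
have -> : [set eta : 'rV[int]_s | eucl R eta <= k%:R] =
    [set` [seq eta <- box s k | eucl R eta <= k%:R]].
  apply/seteqP; split=> eta /=; rewrite mem_filter; last by case/andP.
  move=> ek; rewrite ek /=; apply: mem_box => j.
  have := le_trans (@eta_le_eucl R s eta j) ek.
  by rewrite -intr_norm -[k%:R]/(k%:Z%:~R) ler_int.
apply: etrans (esym (fsbig_seq _ _ _)) _; first by rewrite filter_uniq// uniq_box.
by apply: eq_bigr => eta _; exact: mul_char_eprojs.
Qed.

Lemma partial_sum_linear k : ultralinear m (fourier_partial_sum u k).
Proof.
move=> a b f g fU gU; rewrite !partial_sumE//; last exact: ultradiff_lin.
rewrite !mulr_sumr -big_split; apply: eq_bigr => eta _ /=.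
rewrite (eprojs_lin _ _ a b (ultradiff_tsmooth fU) (ultradiff_tsmooth gU)).
exact: (ul a b (ultradiff_eprojs eta fU) (ultradiff_eprojs eta gU)).
Qed.

Lemma partial_sum_bounded k : ultrabounded m (fourier_partial_sum u k).
Proof.
move=> h h0; have [K K0 HK] := ub h0.
exists ((size (box s k)).+1%:R * (K * 2 ^+ s)).
  by rewrite !mulr_gt0// ?exprn_gt0// ltr0n.
move=> N f fN; have N0 := udball_ge0 m0 h0 fN.
rewrite (partial_sumE _ (udball_ultradiff m0 h0 fN)).
apply: le_trans (normc_sum _ _ _) _.
have B0 : 0 <= K * (2 ^+ s * N) by rewrite !mulr_ge0// ?exprn_ge0// ltW.
apply: (@le_trans _ _ (\sum_(eta <- box s k) K * (2 ^+ s * N))).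
  rewrite [leRHS](bigID (fun eta => eucl R eta <= k%:R))/= -[leLHS]addr0.
  apply: lerD; last by apply: sumr_ge0.
  by apply: ler_sum => eta _; apply: HK; exact: udball_eprojs.
rewrite big_const_seq count_predT iter_addr_0 -[leLHS]mulr_natl.
by rewrite -[leRHS]mulrA -(mulrA K) ler_wpM2r// ler_nat.
Qed.

(** The sum over the cube of side 2k + 1 converges at the rate 1 / k.  A
    frequency of the cube outside the Euclidean ball of radius k has a
    coordinate of size at least k / s, so it contributes O(k^-(s+1)), and
    there are O(k^s) of them. *)
Lemma partial_sum_rate phi : (0 < s)%N -> ultradiff m phi ->
  exists A : R, forall k, normc (fourier_partial_sum u k.+1 phi - u phi) <= A / k.+1%:R.
Proof.
move=> s0 pU; have [h [N [h0 N0 pN]]] := ultradiff_udball pU.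
have ps := ultradiff_tsmooth pU.
have [h1 [C1 [h10 C10 H1]]] := tprojs_rate hm (map (@rshift r s) (enum 'I_s)) h0.
have [h2 [C2 [h20 C20 H2]]] := udball_eprojs_decay hm (@rshift r s) s.+1 h0.
have CN10 : 0 <= C1 * N by rewrite mulr_ge0 ?ltW.
have CN20 : 0 <= C2 * N by rewrite mulr_ge0 ?ltW.
have [K1 K10 HK1] := ub h10; have [K2 K20 HK2] := ub h20.
(* 3 bounds (2k + 1) / k, and the exponent s + 1 beats the number of frequencies *)
exists (K1 * (C1 * N) + 3 ^+ s * s%:R ^+ s.+1 * (K2 * (C2 * N))) => k'.
set k := k'.+1.
have k0 : 0 < k%:R :> R by rewrite ltr0n.
have sp : 0 < s%:R :> R by rewrite ltr0n.
set Q := fun eta => u (eprojs (@rshift r s) eta phi).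
have EU eta := ultradiff_eprojs eta pU.
set T := foldr (fun j g => tproj j k g) phi (map (@rshift r s) (enum 'I_s)).
have TE : T = fun z => \sum_(eta <- box s k) eprojs (@rshift r s) eta phi z.
  by apply/funext => z; exact: tprojs_box.
have TU : ultradiff m T by rewrite TE; exact: ultradiff_sum.
have uT : u T = \sum_(eta <- box s k) Q eta.
  rewrite TE; exact: (ultralinear_sum _ m0 ul EU).
have E : fourier_partial_sum u k phi - u phi =
   - (u (fun z => phi z - T z)) - \sum_(eta <- box s k | ~~ (eucl R eta <= k%:R)) Q eta.
  rewrite (ultralinearB ul pU TU) uT (partial_sumE _ pU).
  rewrite [in RHS](bigID (fun eta => eucl R eta <= k%:R))/= -/Q.
  by ring.
rewrite E; apply: le_trans (normcB _ _) _; rewrite normcN mulrDl; apply: lerD.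
  have [_ B] := H1 N phi k pN.
  apply: le_trans (HK1 _ _ B) _; rewrite -[leRHS]mulrA ler_wpM2l ?(ltW K10)//.
  rewrite ler_wpM2l ?CN10//.
  by rewrite lef_pV2 ?posrE ?ltr0n// ler_nat.
apply: le_trans (normc_sum _ _ _) _.
pose b : R := K2 * (C2 * N / (k%:R / s%:R) ^+ s.+1).
have b0 : 0 <= b.
  by rewrite mulr_ge0 ?(ltW K20)// divr_ge0 ?mulr_ge0 ?exprn_ge0 ?divr_ge0// ltW.
apply: (@le_trans _ _ (\sum_(eta <- box s k) b)).
  rewrite [leRHS](bigID (fun eta => ~~ (eucl R eta <= k%:R)))/= -[leLHS]addr0.
  apply: lerD; last by apply: sumr_ge0.
  apply: ler_sum => eta; rewrite -ltNge => /(eucl_large s0)[j kj].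
  have ks0 : 0 < k%:R / s%:R :> R by rewrite divr_gt0.
  have [B|eta0] := H2 N phi eta j pN; last first.
    by move: kj; rewrite eta0 normr0 leNgt ks0.
  apply: le_trans (HK2 _ _ B) _; rewrite ler_wpM2l ?(ltW K20)//.
  have ej : 0 < `|(eta 0 j)%:~R : R| := lt_le_trans ks0 kj.
  rewrite ler_wpM2l ?CN20//.
  rewrite lef_pV2 ?posrE ?exprn_gt0//.
  by rewrite lerXn2r// ?nnegrE ltW.
rewrite big_const_seq count_predT iter_addr_0 size_box -[leLHS]mulr_natl natrX.
have k3 : k.*2.+1%:R <= 3 * k%:R :> R.
  by rewrite -natrM ler_nat; exact: leq_doubleS_3.
apply: (@le_trans _ _ ((3 * k%:R) ^+ s * b)).
  by rewrite ler_wpM2r// lerXn2r// ?nnegrE ?mulr_ge0.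
rewrite le_eqVlt; apply/orP; left; apply/eqP.
have F (a x y q : R) : q != 0 -> x != 0 -> y != 0 ->
    a * x * (K2 * (C2 * N / (q * x / y))) = a * y * (K2 * (C2 * N)) / q.
  by move=> q0 x0 y0; field; rewrite q0 x0 y0.
rewrite /b exprMn expr_div_n [k%:R ^+ s.+1]exprS.
by apply: F; rewrite ?expf_neq0// gt_eqF.
Qed.

End FourierSeries.

Local Close Scope complex_scope.

Theorem theorem5p6 (R : realType) (m : nat -> R) (hm : weight_sequence m)
    (h_ : nat -> R) (hh : exhausting h_)
    (r s : nat) (r_gt0 : (0 < r)%N) (s_gt0 : (0 < s)%N)
    (u : functional R (r + s)) (hu : ultradist m h_ u) :
  [/\ forall eta : 'rV[int]_s, ultradist m h_ (partial_fourier u eta),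
      ultradist_cvg m h_ (fourier_partial_sum u) u &
      forall eps h : R, 0 < eps -> 0 < h -> exists2 C : R, 0 < C &
        forall (eta : 'rV[int]_s) (psi : 'rV[R]_r -> R[i]),
          ultradiffh m h psi ->
          ((normc (partial_fourier u eta psi))%:E <=
            C%:E * ultranorm m h psi *
            ereal_sup [set (eps ^+ p * (1 + eucl R eta) ^+ p /
                            (m p * p`!%:R))%:E | p in [set: nat]])%E].
Proof.
have m0 := weight_gt0 hm.
have ul := ultradist_linear hu; have ub := ultradist_bounded m0 hh hu.
split.
- move=> eta; apply: (bounded_ultradist m0 hh).
    exact: partial_fourier_linear.
  exact: partial_fourier_bounded.
- split=> //.
    move=> k; apply: (bounded_ultradist m0 hh).
      exact: partial_sum_linear.
    exact: partial_sum_bounded.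
  move=> phi pU; have [A HA] := partial_sum_rate hm ul ub s_gt0 pU.
  apply/cvgrPdist_le => e e0.
  exists (Num.bound (A / e)).+1 => // -[//|k] /= kN.
  rewrite sub0r normrN ger0_norm ?normc_ge0//; apply: le_trans (HA k) _.
  rewrite ler_pdivrMr// mulrC -ler_pdivrMr//.
  have [A0|A0] := leP (A / e) 0; first exact: le_trans A0 _.
  apply: le_trans (ltW (archi_boundP (ltW A0))) _.
  by rewrite ler_nat; exact: ltnW kN.
move=> eps h e0 h0.
have h'0 : 0 < Num.max h eps^-1 by rewrite lt_max h0.
have [K K0 HK] := ub _ h'0.
have P0 : 0 < (2 * pi) ^- s :> R by rewrite invr_gt0 exprn_gt0// twopi_gt0.
exists ((2 * pi) ^- s * K); first exact: mulr_gt0.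
move=> eta psi /(ultradiffh_udball m0 h0)[N [-> pN]].
set S := [set _ | p in _].
have a0 : 0 <= eps * (1 + eucl R eta).
  by rewrite mulr_ge0 ?(ltW e0)// addr_ge0// eucl_ge0.
have SB : (ereal_sup S <= (1 + expR (eps * (1 + eucl R eta)))%:E)%E.
  apply: ge_ereal_sup => _ [p _ <-]; rewrite lee_fin -exprMn.
  exact: (exp_weight_bounded hm a0).
have SG p : ((eps ^+ p * (1 + eucl R eta) ^+ p / (m p * p`!%:R))%:E <= ereal_sup S)%E.
  by apply: ereal_sup_ubound; exists p.
have Sfin : ereal_sup S \is a fin_num.
  rewrite fin_numE; apply/andP; split.
    by rewrite gt_eqF// (lt_le_trans _ (SG 0%N))// ltNyr.
  by rewrite lt_eqF// (le_lt_trans SB)// ltry.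
rewrite -(fineK Sfin) -!EFinM lee_fin partial_fourierE normcM normc_real gtr0_norm//.
rewrite -!mulrA ler_wpM2l ?(ltW P0)//; apply: HK.
apply: udball_tens => // p.
by rewrite -lee_fin fineK.
Qed.
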